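(* For every integer $n\geq 3$, $\delta(A_n)\geq 2n-10$.
   Context: Polygons are treated combinatorially: a convex polygon is a finite set of at least $3$ vertices with a clockwise cyclic order. An edge is a $2$-element set of vertices; two edges cross if they are disjoint and their vertices alternate in the cyclic order. Boundary edges are pairs of cyclically consecutive vertices. A triangulation is an inclusion-maximal set of pairwise non-crossing edges (it contains all boundary edges and $n-3$ other, interior, edges when there are $n$ vertices). For an interior edge $\varepsilon$ of a triangulation $T$, $\varepsilon$ is a diagonal of a unique quadrilateral whose four sides lie in $T$; $T/\varepsilon$ denotes the triangulation obtained by replacing $\varepsilon$ with the other diagonal (a flip). A path of length $k$ from $U$ to $V$ is a sequence $U=T_0,\dots,T_k=V$ in which each $T_{i+1}$ is obtained from $T_i$ by a flip; it is geodesic if its length is minimal. For a pair $P=\{U,V\}$, $\delta(P)$ is the length of a geodesic path between $U$ and $V$ (flip distance). Deletion: if $a$ is a vertex of a polygon $\pi$ with at least $4$ vertices and $b$ its clockwise successor, $\pi\ominus a$ is the polygon with vertex $a$ removed (cyclic order kept), and for a triangulation $T$ of $\pi$, $T\ominus a=\{\varepsilon \text{ with } a \text{ replaced by } b : \varepsilon\in T\setminus\{\{a,b\}\}\}$, a triangulation of $\pi\ominus a$. For a pair, $\{U,V\}\ominus a=\{U\ominus a,V\ominus a\}$. Zigzag: for $N\geq 4$, on the polygon with vertices $0,\dots,N-1$ labeled clockwise (labels taken modulo $N$), $Z_N$ is the triangulation whose interior edges are $\varepsilon_1,\dots,\varepsilon_{N-3}$ with $\varepsilon_{2k+1}=\{2-k,4+k\}$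 and $\varepsilon_{2k+2}=\{1-k,4+k\}$ for $k\geq 0$. In a polygon with $N$ vertices, $\bar{k}$ denotes the vertex $k+\lfloor N/2\rfloor$. Pair $A_n$ ($n\geq 3$): $A_n^-$ is obtained from $Z_{n+4}$ by deleting successively the vertices $0$, $1$, $\bar 0$, $\bar 1$ (with $\bar k=k+\lfloor (n+4)/2\rfloor$, labels of $Z_{n+4}$), and then relabeling the remaining $n$ vertices clockwise $0,\dots,n-1$ so that the vertex labeled $2$ keeps label $2$. $A_n^+$ is obtained from $Z_{n+4}$ by deleting successively $4$, $5$, $\bar 4$, $\bar 5$, and relabeling the remaining vertices clockwise $0,\dots,n-1$ so that the former vertex $2$ gets label $1$. Both are regarded as triangulations of the same polygon with vertices $0,\dots,n-1$ in clockwise order, and $A_n=\{A_n^-,A_n^+\}$. *)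

(* Defs.v *)
From mathcomp Require Import all_boot all_algebra.

Set Implicit Arguments.
Unset Strict Implicit.
Unset Printing Implicit Defensive.

(** A polygon with vertices in [V] is a duplicate-free sequence of at least 3
    vertices, listed clockwise and read cyclically: [next c a] is the clockwise
    successor of [a], and all notions below are invariant under [rot]. *)

Section Polygon.
Variables (V : finType) (c : seq V).
Implicit Types (s : seq V) (e f : {set V}) (T : {set {set V}}).

Definition clockwise s := [exists i : 'I_(size c), subseq s (rot i c)].

Definition edge e := (#|e| == 2) && (e \subset c).

Definition boundary_edge e := [exists a in c, e == [set a; next c a]].

Definition crosses e f :=
  [disjoint e & f] &&
  [exists a, exists x, exists b, exists y,
    [&& e == [set a; b], f == [set x; y] & clockwise [:: a; x; b; y]]].

Definition noncrossing T :=
  [forall e in T, edge e] &&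
  [forall e in T, forall f in T, ~~ crosses e f].

Definition triangulation T := maxset noncrossing T.

Definition interior_edge e := edge e && ~~ boundary_edge e.

(** [T'] is [T / e]. *)
Definition flip_at T e T' :=
  [&& e \in T, interior_edge e &
  [exists a, exists x, exists b, exists y,
    [&& clockwise [:: a; x; b; y], e == [set a; b],
        [set [set a; x]; [set x; b]; [set b; y]; [set y; a]] \subset T
      & T' == [set x; y] |: (T :\ e)]]].

Definition flip T T' := [exists e, flip_at T e T'].

(** The path is [T :: p], of length [size p]. *)
Definition flip_path T T' (p : seq {set {set V}}) :=
  [&& all triangulation (T :: p), path flip T p & last T p == T'].

Definition geodesic T T' (p : seq {set {set V}}) :=
  flip_path T T' p /\ forall q, flip_path T T' q -> size p <= size q.

(** [flip_distance T T' d] states that the flip distance is defined (there is a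
    path) and equal to [d]. *)
Definition flip_distance T T' (d : nat) :=
  exists2 p, geodesic T T' p & size p = d.

Lemma flip_distance_inj T T' d d' :
  flip_distance T T' d -> flip_distance T T' d' -> d = d'.
Proof.
move=> [p [pP pmin] <-] [q [qP qmin] <-].
by apply/eqP; rewrite eqn_leq pmin ?qmin.
Qed.

Definition delete_vertex T (a : V) : {set {set V}} :=
  let b := next c a in
  [set [set if x == a then b else x | x in e] | e : {set V} in T :\ [set a; b]].

End Polygon.

Definition delete (V : finType) (P : seq V * {set {set V}}) (a : V) :=
  (rem a P.1, delete_vertex P.1 P.2 a).

Definition deletes (V : finType) (P : seq V * {set {set V}}) (s : seq V) :=
  foldl (@delete V) P s.

(** Vertices of the [N]-gon ([N >= 2] is required for ['Z_N] to be Z/NZ). *)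
Definition ngon (N : nat) : seq 'Z_N := [seq (k%:R)%R | k <- iota 0 N].

(** [zigzag_edge N i] is epsilon_(i+1); thus i = 2k or i = 2k+1. *)
Definition zigzag_edge (N i : nat) : {set 'Z_N} :=
  let k := i./2 in
  if odd i then [set (1 - k%:R)%R; (4 + k%:R)%R]
  else [set (2 - k%:R)%R; (4 + k%:R)%R].

Definition zigzag (N : nat) : {set {set 'Z_N}} :=
  [set e | boundary_edge (ngon N) e] :|:
  [set zigzag_edge N i | i : 'I_(N - 3)].

Definition opp_vertex (N k : nat) : 'Z_N := ((k + N./2)%:R)%R.

(** Renames clockwise the vertices of the polygon [P.1] by elements of ['Z_n],
    the vertex [v] receiving the label [l]. *)
Definition relabel (V : finType) (n : nat) (v : V) (l : 'Z_n)
    (P : seq V * {set {set V}}) : {set {set 'Z_n}} :=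
  let label x := (l + (index x (rot (index v P.1) P.1))%:R)%R in
  [set [set label x | x in e] | e : {set V} in P.2].

Definition A_minus (n : nat) : {set {set 'Z_n}} :=
  let N := n + 4 in
  relabel (2 : 'Z_N)%R (2 : 'Z_n)%R
    (deletes (ngon N, zigzag N)
       [:: 0%R; 1%R; opp_vertex N 0; opp_vertex N 1]).

Definition A_plus (n : nat) : {set {set 'Z_n}} :=
  let N := n + 4 in
  relabel (2 : 'Z_N)%R (1 : 'Z_n)%R
    (deletes (ngon N, zigzag N)
       [:: 4%R; 5%R; opp_vertex N 4; opp_vertex N 5]).

(* Main.v *)
Require Import Defs.
From mathcomp Require Import all_boot all_algebra zify.

Set Implicit Arguments.
Unset Strict Implicit.
Unset Printing Implicit Defensive.

Import GRing.Theory.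

(** Linear-programming duality.  Suppose every triple of vertices p < q < r has
    a weight w(p, q, r) such that, for all p < q < r < s,
      | w(p, q, r) + w(p, r, s) - w(p, q, s) - w(q, r, s) | <= 2.
    A flip replaces two triangles of a triangulation by the other two triangles
    of a quadrilateral, so it changes the total weight of the triangles by at
    most 2, and half the difference of the total weights bounds the flip
    distance from below.  For the weights below, the total weights of the two
    triangulations of A_n differ by at least 2 (2n - 10).

    The weights were found as an optimal solution of the linear program that
    maximises this difference.  Number the vertices by the integers x in
    [h + 1 - n, h], where h = floor((n + 4) / 2), and call them left if x <= 2
    and right otherwise.  Away from the two combs, the edges {x, y} of A_n^-
    joining a left to a right vertex are those with x + y = 7 or 8, and those of
    A_n^+ have x + y = 1 or 2; the weight of a triangle with vertices on both
    sides depends on the two sums x + y of its left-right edges only.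

    That the distance is defined follows from the correspondence between binary
    trees and triangulations: tree rotations are flips, and all trees with the
    same number of leaves are connected by rotations. *)

(** * Weights *)

(* A vertex x is represented by the natural number x + n, a sum x + y by
   x + y + b with b = 2n, and all weights are shifted by 2; the shift is
   harmless because all triangulations have the same number of triangles. *)
Definition positive_sum b s := (b + 2 <= s <= b + 4) || (b + 8 <= s).

(** Up to the shift [b], [p] and [q] are the sums along the two left-right edges, so [q - p] is the
    gap between the two vertices on the same side. Only gap 1 occurs in the two triangulations of
    A_n: the weight peaks at 4 for the sums 1, 2 of the zigzag of A_n^+ and drops to 0 for the sums
    7, 8 of that of A_n^-. *)
Definition cross_weight b p q : nat :=
  if p + 3 <= q then (positive_sum b p + positive_sum b q).+1
  else if p + 2 <= q then
    if b <= p <= b + 1 then 3 else if b + 6 <= p <= b + 7 then 1 else 2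
  else if p <= b then 3 else if p <= b + 1 then 4 else if p <= b + 3 then 3
  else if p <= b + 4 then 2 else if p == b + 7 then 0 else 1.

(** Depends on the two gaps only, hence is invariant under translation. Reversing the order of the
    vertices exchanges the values 3 and 1. *)
Definition side_weight p q r : nat :=
  if (q <= p + 1) && (q + 3 <= r) then 3
  else if (r <= q + 1) && (p + 3 <= q) then 1 else 2.

Definition weight n p q r : nat :=
  if (n + 3 <= p) || (r <= n + 2) then side_weight p q r
  else if q <= n + 2 then cross_weight (2 * n) (p + r) (q + r)
  else cross_weight (2 * n) (p + q) (p + r).

Lemma side_weight_cocycle p q r s : p < q < r -> r < s ->
  side_weight p q r + side_weight p r s <=
    side_weight p q s + side_weight q r s + 2 /\
  side_weight p q s + side_weight q r s <=
    side_weight p q r + side_weight p r s + 2.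
Proof.
move=> /andP[? ?] ?; rewrite /side_weight.
by repeat (case: ifP => ?; try lia).
Qed.

(** Case of three vertices on one side and one vertex v on the other: [p], [q], [r] are the sums
    with v, and by translation invariance the weight of the triangle avoiding v can be read off
    these sums. *)
Lemma cross_side_cocycle b p q r : p < q < r ->
  cross_weight b p q + cross_weight b q r <=
    cross_weight b p r + side_weight p q r + 2 /\
  cross_weight b p r + side_weight p q r <=
    cross_weight b p q + cross_weight b q r + 2.
Proof.
move=> /andP[? ?]; rewrite /side_weight /cross_weight /positive_sum.
by repeat (case: ifP => ?; try lia).
Qed.

(** Case of two vertices on each side: with gaps [d] and [e] and smallest sum [s], the four
    left-right sums are s, s + d, s + e and s + d + e. *)
Lemma cross_cross_cocycle b s d e : 0 < d -> 0 < e ->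
  cross_weight b s (s + d) + cross_weight b s (s + e) <=
  cross_weight b (s + e) (s + d + e) + cross_weight b (s + d) (s + d + e) + 2 /\
  cross_weight b (s + e) (s + d + e) + cross_weight b (s + d) (s + d + e) <=
  cross_weight b s (s + d) + cross_weight b s (s + e) + 2.
Proof.
move=> ? ?; rewrite /cross_weight /positive_sum.
by repeat (case: ifP => ?; try lia).
Qed.

Lemma weight_cocycle n p q r s : p < q < r -> r < s ->
  weight n p q r + weight n p r s <= weight n p q s + weight n q r s + 2 /\
  weight n p q s + weight n q r s <= weight n p q r + weight n p r s + 2.
Proof.
move=> /andP[pq qr] rs; rewrite /weight.
have [lp|lp] := leqP (n + 3) p.
  have -> : n + 3 <= q by lia.
  by apply: side_weight_cocycle; rewrite ?pq.
have [ls|ls] := leqP s (n + 2).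
  have -> : r <= n + 2 by lia.
  by rewrite /= orbT; apply: side_weight_cocycle; rewrite ?pq.
have [lr|lr] /= := leqP r (n + 2).
  have -> : (n + 3 <= q) = false by lia.
  have -> : q <= n + 2 by lia.
  rewrite /=.
  have H := @cross_side_cocycle (2 * n) (p + s) (q + s) (r + s) ltac:(lia).
  have <- : side_weight (p + s) (q + s) (r + s) = side_weight p q r.
    by rewrite /side_weight !(addnAC _ s) !leq_add2r.
  lia.
have [lq|lq] /= := leqP (n + 3) q.
  have -> : (q <= n + 2) = false by lia.
  have H := @cross_side_cocycle (2 * n) (p + q) (p + r) (p + s) ltac:(lia).
  have <- : side_weight (p + q) (p + r) (p + s) = side_weight q r s.
    by rewrite /side_weight -!addnA !leq_add2l.
  lia.
have -> : q <= n + 2 by lia.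
have := @cross_cross_cocycle (2 * n) (p + r) (q - p) (s - r) ltac:(lia) ltac:(lia).
have -> : p + r + (q - p) = q + r by lia.
have -> : p + r + (s - r) = p + s by lia.
have -> : q + r + (s - r) = q + s by lia.
lia.
Qed.

(** * The potential of a triangulation *)

Definition cyclic4 (p q r s : nat) :=
  [|| (p < q < r) && (r < s), (q < r < s) && (s < p),
      (r < s < p) && (p < q) | (s < p < q) && (q < r)].

Ltac order_lia :=
  repeat match goal with
  | H : is_true (_ \in _) |- _ => clear H
  | H : is_true (~~ _) |- _ => clear H
  end; lia.

Section Potential.
Variables (V : finType) (c : seq V) (pos : V -> nat) (w : nat -> nat -> nat -> nat).
Hypothesis pos_inj : injective pos.
Hypothesis clockwiseE : forall a x b y,
  clockwise c [:: a; x; b; y] = cyclic4 (pos a) (pos x) (pos b) (pos y).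
Hypothesis w_cocycle : forall p q r s, p < q < r -> r < s ->
  w p q r + w p r s <= w p q s + w q r s + 2 /\
  w p q s + w q r s <= w p q r + w p r s + 2.
Implicit Types T S : {set {set V}}.

Lemma set2_inj (a b x y : V) :
  ([set a; b] == [set x; y]) = (a == x) && (b == y) || (a == y) && (b == x).
Proof.
apply/eqP/idP; last first.
  by case/orP=> /andP[/eqP-> /eqP->] //; rewrite setUC.
move=> E.
have := set21 a b; have := set22 a b; have := set21 x y; have := set22 x y.
rewrite {1 2}E; rewrite -{1 2}E !inE.
by do 4![case/orP=> /eqP ?]; subst; rewrite ?eqxx ?orbT.
Qed.

Lemma crosses_pos a b x y : pos a < pos x < pos b -> pos b < pos y ->
  crosses c [set a; b] [set x; y].
Proof.
move=> /andP[ax xb] by'; apply/andP; split.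
  rewrite -setI_eq0; apply/eqP/setP=> z; rewrite !inE; apply/negP.
  by case/andP=> /orP[]/eqP-> /orP[]/eqP/(congr1 pos); lia.
apply/existsP; exists a; apply/existsP; exists x.
apply/existsP; exists b; apply/existsP; exists y.
by rewrite !eqxx clockwiseE /cyclic4 ax xb by'.
Qed.

(** Cutting the cyclic order into a linear one leaves four cases, according to which end comes
    first; if it is an end of [f], the two edges exchange roles. *)
Lemma crosses_posP e f : crosses c e f -> exists a b x y,
  [/\ (e = [set a; b] /\ f = [set x; y]) \/ (f = [set a; b] /\ e = [set x; y]),
      pos a < pos x < pos b & pos b < pos y].
Proof.
case/andP=> _ /existsP[a /existsP[x /existsP[b /existsP[y]]]].
case/and3P=> /eqP-> /eqP->; rewrite clockwiseE.
case/or4P=> /andP[H1 H2].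
- by exists a, b, x, y; split=> //; left.
- by exists x, y, b, a; split=> //; right; split=> //; rewrite setUC.
- by exists b, a, y, x; split=> //; left; split; rewrite setUC.
- by exists y, x, a, b; split=> //; right; split=> //; rewrite setUC.
Qed.

Lemma noncrossing_pos T a b x y : noncrossing c T ->
  [set a; b] \in T -> [set x; y] \in T ->
  pos a < pos x < pos b -> pos b < pos y -> False.
Proof.
case/andP=> _ /forall_inP H ab xy h1 h2.
by have /forall_inP/(_ _ xy) := H _ ab; rewrite crosses_pos.
Qed.

(** All vertices of a convex polygon lie on its boundary, so three edges of a triangulation joining
    three vertices pairwise bound a face. Ordering the vertices by position counts each face
    once. *)
Definition triangle T (t : V * V * V) :=
  [&& pos t.1.1 < pos t.1.2, pos t.1.2 < pos t.2, [set t.1.1; t.1.2] \in T,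
      [set t.1.2; t.2] \in T & [set t.1.1; t.2] \in T].

Definition potential T :=
  \sum_(t | triangle T t) w (pos t.1.1) (pos t.1.2) (pos t.2).

Lemma potential_add T e t1 t2 : e \notin T -> t1 != t2 ->
  (forall t, triangle (e |: T) t && ~~ triangle T t = ((t == t1) || (t == t2))) ->
  potential (e |: T) = potential T + w (pos t1.1.1) (pos t1.1.2) (pos t1.2)
                                   + w (pos t2.1.1) (pos t2.1.2) (pos t2.2).
Proof.
move=> eT t12 H.
rewrite /potential (bigID (triangle T)) /= -addnA; congr (_ + _).
  apply: eq_bigl => t; apply/andP/idP => [[]//|tT]; split=> //.
  case/and5P: tT => h1 h2 h3 h4 h5.
  by rewrite /triangle h1 h2 !inE h3 h4 h5 !orbT.
rewrite (eq_bigl _ _ H) (bigD1 t1) ?eqxx //=; congr (_ + _).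
rewrite (bigD1 t2) /=; last by rewrite eqxx orbT eq_sym.
rewrite big1 ?addn0 // => t.
by case/andP=> /andP[/orP[]/eqP-> ]; rewrite ?eqxx.
Qed.

Definition quad T a x b y :=
  [&& [set a; x] \in T, [set x; b] \in T, [set b; y] \in T & [set a; y] \in T].

(** A new triangle has {a, b} as a side. The sides of the quadrilateral must not be crossed, which
    leaves one third vertex on each side of {a, b}: [x] between [a] and [b], and [y] beyond [b]. *)
Lemma potential_add_lower T a x b y : noncrossing c ([set a; b] |: T) ->
  [set a; b] \notin T -> quad T a x b y ->
  pos a < pos x < pos b -> pos b < pos y ->
  potential ([set a; b] |: T) = potential T + w (pos a) (pos x) (pos b)
                                            + w (pos a) (pos b) (pos y).
Proof.
move=> nc abT /and4P[ax xb by' ay] h1 h2.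
have nc' := noncrossing_pos nc.
have inT u v : [set u; v] \in T -> [set u; v] \in [set a; b] |: T.
  by rewrite !inE => ->; rewrite orbT.
apply: (@potential_add _ _ (a, x, b) (a, b, y)) => //.
  by apply/eqP=> -[/(congr1 pos)]; order_lia.
move=> [[u v] t]; rewrite /triangle /=.
apply/idP/idP; last first.
  case/orP=> /eqP[-> -> ->];
    rewrite !inE !eqxx (negPf abT) ?ax ?xb ?by' ?ay ?orbT ?andbF /=; order_lia.
case/andP=> /and5P[uv vt uvT vtT utT].
rewrite uv vt /= => nT.
have [E|E1] := boolP ([set u; t] == [set a; b]).
  move: E; rewrite set2_inj => /orP[]/andP[/eqP ? /eqP ?]; subst; last by order_lia.
  suff -> : v = x by rewrite eqxx.
  apply: pos_inj; have [l|l|//] := ltngtP (pos v) (pos x).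
    by case: (nc' a x v b (inT _ _ ax) vtT); order_lia.
  by case: (nc' a v x b uvT (inT _ _ xb)); order_lia.
have [E|E2] := boolP ([set u; v] == [set a; b]).
  move: E; rewrite set2_inj => /orP[]/andP[/eqP ? /eqP ?]; subst; last by order_lia.
  suff -> : t = y by rewrite eqxx orbT.
  apply: pos_inj; have [l|l|//] := ltngtP (pos t) (pos y).
    by case: (nc' a t b y utT (inT _ _ by')); order_lia.
  by case: (nc' a y b t (inT _ _ ay) vtT); order_lia.
(* Here [u] would come before [a], and {u, b} would cross {a, y}. *)
have [E|E3] := boolP ([set v; t] == [set a; b]).
  move: E; rewrite set2_inj => /orP[]/andP[/eqP ? /eqP ?]; subst; last by order_lia.
  by case: (nc' u b a y utT (inT _ _ ay)); order_lia.
by move: uvT vtT utT nT; rewrite !inE (negPf E1) (negPf E2) (negPf E3) /= => -> -> ->.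
Qed.

Lemma potential_add_upper T a x b y : noncrossing c ([set x; y] |: T) ->
  [set x; y] \notin T -> quad T a x b y ->
  pos a < pos x < pos b -> pos b < pos y ->
  potential ([set x; y] |: T) = potential T + w (pos a) (pos x) (pos y)
                                            + w (pos x) (pos b) (pos y).
Proof.
move=> nc xyT /and4P[ax xb by' ay] h1 h2.
have nc' := noncrossing_pos nc.
have inT u v : [set u; v] \in T -> [set u; v] \in [set x; y] |: T.
  by rewrite !inE => ->; rewrite orbT.
apply: (@potential_add _ _ (a, x, y) (x, b, y)) => //.
  by apply/eqP=> -[/(congr1 pos)]; order_lia.
move=> [[u v] t]; rewrite /triangle /=.
apply/idP/idP; last first.
  case/orP=> /eqP[-> -> ->];
    rewrite !inE !eqxx (negPf xyT) ?ax ?xb ?by' ?ay ?orbT ?andbF /=; order_lia.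
case/andP=> /and5P[uv vt uvT vtT utT].
rewrite uv vt /= => nT.
have [E|E1] := boolP ([set u; t] == [set x; y]).
  move: E; rewrite set2_inj => /orP[]/andP[/eqP ? /eqP ?]; subst; last by order_lia.
  suff -> : v = b by rewrite eqxx orbT.
  apply: pos_inj; have [l|l|//] := ltngtP (pos v) (pos b).
    by case: (nc' x b v y (inT _ _ xb) vtT); order_lia.
  by case: (nc' x v b y uvT (inT _ _ by')); order_lia.
have [E|E2] := boolP ([set u; v] == [set x; y]).
  move: E; rewrite set2_inj => /orP[]/andP[/eqP ? /eqP ?]; subst; last by order_lia.
  by case: (nc' a y x t (inT _ _ ay) utT); order_lia.
have [E|E3] := boolP ([set v; t] == [set x; y]).
  move: E; rewrite set2_inj => /orP[]/andP[/eqP ? /eqP ?]; subst; last by order_lia.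
  suff -> : u = a by rewrite eqxx.
  apply: pos_inj; have [l|l|//] := ltngtP (pos u) (pos a).
    by case: (nc' u x a y uvT (inT _ _ ay)); order_lia.
  by case: (nc' a x u y (inT _ _ ax) utT); order_lia.
by move: uvT vtT utT nT; rewrite !inE (negPf E1) (negPf E2) (negPf E3) /= => -> -> ->.
Qed.

Lemma potential_flip T T' : noncrossing c T -> noncrossing c T' -> flip c T T' ->
  potential T' <= potential T + 2.
Proof.
move=> ncT ncT' /existsP[e /and3P[eT _]].
case/existsP=> a /existsP[x /existsP[b /existsP[y]]].
case/and4P=> cl /eqP Ee sub /eqP ET'.
move: cl; rewrite clockwiseE => cl.
(* Both triangulations are [S] with one diagonal added, so only the two triangles on each diagonal
   have to be compared. *)
pose S := T :\ e.
have neq u v : [set u; v] \in T -> [set u; v] != [set a; b] -> [set u; v] \in S.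
  by move=> h1 h2; rewrite !inE Ee h2.
have [[pax pay pbx pby] [pab pxy]] : [/\ a != x, a != y, b != x & b != y] /\ a != b /\ x != y.
  by do ?split; apply/eqP=> E; move: cl; rewrite /cyclic4 E; lia.
have eS : [set a; b] \notin S by rewrite !inE Ee eqxx.
have axT : [set a; x] \in T by apply: (subsetP sub); rewrite !inE eqxx.
have xbT : [set x; b] \in T by apply: (subsetP sub); rewrite !inE eqxx !orbT.
have byT : [set b; y] \in T by apply: (subsetP sub); rewrite !inE eqxx !orbT.
have yaT : [set y; a] \in T by apply: (subsetP sub); rewrite !inE eqxx !orbT.
have [axS xbS byS yaS] : [/\ [set a; x] \in S, [set x; b] \in S,
    [set b; y] \in S & [set y; a] \in S].
  by split; apply: neq => //;
    rewrite set2_inj ?eqxx /= ?(eq_sym x) ?(eq_sym y) ?(negPf pax) ?(negPf pay) ?(negPf pbx) ?(negPf pby) ?andbF.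
have TE : T = [set a; b] |: S by rewrite /S Ee setD1K // -Ee.
have xyS : [set x; y] \notin S.
  apply/negP=> H; have {}H : [set x; y] \in T by rewrite TE in_setU1 H orbT.
  have H' : [set a; b] \in T by rewrite -Ee.
  have nc' := noncrossing_pos ncT.
  move: cl => /or4P[]/andP[h1 h2].
  - by apply: (nc' a b x y).
  - by apply: (nc' x y b a) => //; rewrite setUC.
  - by apply: (nc' b a y x) => //; rewrite setUC.
  - by apply: (nc' y x a b) => //; rewrite setUC.
move: ncT' ncT; rewrite ET' -/S TE => ncT' ncT.
have C u v : [set u; v] = [set v; u] by rewrite setUC.
(* The quadrilateral is read from its lowest vertex: if this is [a] or [b], the removed diagonal
   passes through it, otherwise the new one does. *)
move: cl => /or4P[]/andP[h1 h2].
- have q : quad S a x b y by rewrite /quad axS xbS byS C yaS.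
  rewrite (potential_add_lower ncT eS q) // (potential_add_upper ncT' xyS q) //.
  by have := w_cocycle h1 h2; clear; lia.
- have q : quad S x b y a by rewrite /quad xbS byS yaS C axS.
  rewrite C in ncT eS; rewrite [[set a; b]]C.
  rewrite (potential_add_upper ncT eS q) // (potential_add_lower ncT' xyS q) //.
  by have := w_cocycle h1 h2; clear; lia.
- have q : quad S b y a x by rewrite /quad byS yaS axS C xbS.
  rewrite C in ncT eS; rewrite [[set a; b]]C.
  rewrite C in ncT' xyS; rewrite [[set x; y]]C.
  rewrite (potential_add_lower ncT eS q) // (potential_add_upper ncT' xyS q) //.
  by have := w_cocycle h1 h2; clear; lia.
- have q : quad S y a x b by rewrite /quad yaS axS xbS C byS.
  rewrite C in ncT' xyS; rewrite [[set x; y]]C.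
  rewrite (potential_add_upper ncT eS q) // (potential_add_lower ncT' xyS q) //.
  by have := w_cocycle h1 h2; clear; lia.
Qed.

Lemma potential_flip_path T T' p : flip_path c T T' p ->
  potential T' <= potential T + 2 * size p.
Proof.
case/and3P; elim: p T => [|U p IH] T /=; first by move=> _ _ /eqP->; rewrite addn0.
case/and3P=> tT tU tp /andP[TU Up] lp.
have nc X : triangulation c X -> noncrossing c X by case/maxsetP.
have := IH U; rewrite /= tU tp => /(_ isT Up lp).
have := potential_flip (nc _ tT) (nc _ tU) TU; lia.
Qed.

End Potential.

(** * Triangulations from binary trees *)

Inductive tree := Leaf | Node of tree & tree.

Fixpoint width t := if t is Node l r then width l + width r else 1.

(** The tree sits on the vertices i, ..., i + [width t]. Leaves are the sides between consecutive
    vertices, a subtree is the edge spanning its leaves, and the triangle on this edge has its apex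
    where the left subtree ends. *)
Fixpoint tree_edges t i : seq (nat * nat) :=
  (i, i + width t) ::
  if t is Node l r then tree_edges l i ++ tree_edges r (i + width l) else [::].

Fixpoint tree_triangles t i : seq (nat * nat * nat) :=
  if t is Node l r then
    (i, i + width l, i + width t) ::
    tree_triangles l i ++ tree_triangles r (i + width l)
  else [::].

Lemma width_gt0 t : 0 < width t.
Proof. by elim: t => //= l IHl r IHr; lia. Qed.

Lemma tree_edges_root t i : (i, i + width t) \in tree_edges t i.
Proof. by case: t => [|l r]; rewrite inE eqxx. Qed.

Lemma tree_edges_bound t i p q : (p, q) \in tree_edges t i ->
  [/\ i <= p, p < q & q <= i + width t].
Proof.
elim: t i => [|l IHl r IHr] i /=; rewrite in_cons ?mem_cat ?in_nil.
  by case/orP=> // /eqP[-> ->]; split; lia.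
have := width_gt0 l; have := width_gt0 r => hr hl.
by case/or3P => [/eqP[-> ->]|/IHl[]|/IHr[]]; split; lia.
Qed.

Lemma tree_edges_noncrossing t i p q r s :
  (p, q) \in tree_edges t i -> (r, s) \in tree_edges t i ->
  p < r < q -> q < s -> False.
Proof.
elim: t i => [|a IHa b IHb] i /=; rewrite !in_cons ?mem_cat ?in_nil.
  by rewrite !orbF => /eqP[-> ->] /eqP[-> ->]; lia.
case/or3P=> [/eqP[-> ->]|H|H] /or3P[/eqP[-> ->]|K|K].
- by lia.
- by have [] := tree_edges_bound K; lia.
- by have [] := tree_edges_bound K; lia.
- by have [] := tree_edges_bound H; lia.
- exact: IHa H K.
- by have [] := tree_edges_bound H; have [] := tree_edges_bound K; lia.
- by have [] := tree_edges_bound H; lia.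
- by have [] := tree_edges_bound H; have [] := tree_edges_bound K; lia.
- exact: IHb H K.
Qed.

(** A pair that fits in neither subtree straddles the apex k; unless it is the root edge, it crosses
    one of the edges joining k to the two ends of the root edge. *)
Lemma tree_edges_maximal t i p q : i <= p -> p < q -> q <= i + width t ->
  (p, q) \in tree_edges t i \/
  exists r s, (r, s) \in tree_edges t i /\
    ((p < r < q) && (q < s) || (r < p < s) && (s < q)).
Proof.
elim: t i => [|a IHa b IHb] i /= ip pq qi.
  by left; rewrite inE; apply/eqP; congr (_, _); lia.
have [qk|qk] := leqP q (i + width a).
  case: (IHa i ip pq qk) => [H|[r [s [H K]]]]; [left|right; exists r, s; split=> //];
  by rewrite in_cons mem_cat H !orbT.
have [kp|kp] := leqP (i + width a) p.
  have qi' : q <= i + width a + width b by lia.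
  case: (IHb _ kp pq qi') => [H|[r [s [H K]]]]; [left|right; exists r, s; split=> //];
  by rewrite in_cons mem_cat H !orbT.
have [pi|pi] := eqVneq p i.
  have [qj|qj] := eqVneq q (i + (width a + width b)).
    by left; rewrite pi qj in_cons eqxx.
  right; exists (i + width a), (i + width a + width b); split; last by lia.
  by rewrite in_cons mem_cat tree_edges_root !orbT.
right; exists i, (i + width a); split; last by lia.
by rewrite in_cons mem_cat tree_edges_root !orbT.
Qed.

Lemma tree_triangles_bound t i x : x \in tree_triangles t i ->
  [/\ i <= x.1.1, x.1.1 < x.1.2, x.1.2 < x.2 & x.2 <= i + width t].
Proof.
elim: t i => [|l IHl r IHr] i //=; rewrite in_cons mem_cat.
have := width_gt0 l; have := width_gt0 r => hr hl.
by case/or3P => [/eqP->|/IHl[]|/IHr[]] /=; split; lia.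
Qed.

Lemma tree_triangles_uniq t i : uniq (tree_triangles t i).
Proof.
elim: t i => [|l IHl r IHr] i //=; rewrite cat_uniq IHl IHr mem_cat !andbT.
have := width_gt0 l; have := width_gt0 r => hr hl.
apply/andP; split.
  by apply/negP=> /orP[]/tree_triangles_bound[] /=; lia.
apply/hasPn=> x /tree_triangles_bound[] H1 H2 H3 H4; apply/negP.
by move=> /tree_triangles_bound[]; lia.
Qed.

(** Induction on the subtree containing the longest edge. If (p, r) is the root edge, then (p, q)
    lies in the left subtree and (q, r) in the right one, which forces [q] to be the apex. *)
Lemma tree_trianglesP t i p q r :
  [&& (p, q) \in tree_edges t i, (q, r) \in tree_edges t i &
      (p, r) \in tree_edges t i] = ((p, q, r) \in tree_triangles t i).
Proof.
elim: t i => [|a IHa b IHb] i.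
  apply/negP; case/and3P=> /tree_edges_bound[? ? ?] /tree_edges_bound[? ? ?] _.
  by move: (width_gt0 Leaf) => /=; simpl in *; lia.
have ha := width_gt0 a; have hb := width_gt0 b.
apply/and3P/idP => /= [[]|]; rewrite !in_cons !mem_cat -?IHa -?IHb; last first.
  case/or3P=> [/eqP[-> -> ->]|/and3P[-> -> ->]|/and3P[-> -> ->]]; rewrite ?orbT //.
  by split; rewrite ?addnA ?tree_edges_root ?eqxx ?orbT.
move=> pq qr /or3P[/eqP[Ep Er]|pr|pr];
  have [? pq' ?] := @tree_edges_bound (Node a b) i p q ltac:(by rewrite in_cons mem_cat);
  have [? qr' ?] := @tree_edges_bound (Node a b) i q r ltac:(by rewrite in_cons mem_cat).
- apply/or3P/Or31; subst p r.
  case/or3P: pq => [/eqP[E]|H|/tree_edges_bound[]]; last by lia.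
    by case/or3P: qr => [/eqP[]|/tree_edges_bound[]|/tree_edges_bound[]]; lia.
  have [? ? ?] := tree_edges_bound H.
  case/or3P: qr => [/eqP[]|/tree_edges_bound[]|/tree_edges_bound[]] *; try lia.
  by apply/eqP; congr (_, _, _); lia.
- have [? ? ?] := tree_edges_bound pr.
  apply/or3P/Or32; rewrite pr andbT.
  case/or3P: pq => [/eqP[? ?]|->|/tree_edges_bound[? ? ?]]; [exfalso; lia| |exfalso; lia].
  by case/or3P: qr => [/eqP[? ?]|->|/tree_edges_bound[? ? ?]] //; exfalso; lia.
- have [? ? ?] := tree_edges_bound pr.
  apply/or3P/Or33; rewrite pr andbT.
  case/or3P: qr => [/eqP[? ?]|/tree_edges_bound[? ? ?]|->]; [exfalso; lia|exfalso; lia|].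
  by case/or3P: pq => [/eqP[? ?]|/tree_edges_bound[? ? ?]|->] //; exfalso; lia.
Qed.

(** * Rotations of binary trees and their connectedness *)

Inductive rotation : tree -> tree -> Prop :=
| rotation_root a b d : rotation (Node (Node a b) d) (Node a (Node b d))
| rotation_left a a' b : rotation a a' -> rotation (Node a b) (Node a' b)
| rotation_right a b b' : rotation b b' -> rotation (Node a b) (Node a b').

Lemma rotation_width t t' : rotation t t' -> width t = width t'.
Proof. by elim=> /= *; lia. Qed.

Ltac mem_cases := repeat case: (_ == _) => //=; repeat case: (_ \in _) => //=.

(** The three subtrees moved by the rotation span [p, q], [q, r] and [r, s]. [S] lists the common
    edges, among them the four sides of the quadrilateral whose diagonals are exchanged. *)
Lemma rotation_edges t t' i : rotation t t' -> exists p q r s S,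
  [/\ [/\ i <= p, p < q, q < r, r < s & s <= i + width t],
      tree_edges t i =i (p, r) :: S, tree_edges t' i =i (q, s) :: S,
      (p, r) \notin S /\ (q, s) \notin S &
      [/\ (p, q) \in S, (q, r) \in S, (r, s) \in S & (p, s) \in S]].
Proof.
move=> R; elim: R i => [a b d|a a' b R IH|a b b' R IH] i /=.
- have [ha hb hd] := And3 (width_gt0 a) (width_gt0 b) (width_gt0 d).
  exists i, (i + width a), (i + width a + width b), (i + width a + width b + width d).
  exists ((i, i + width a + width b + width d) ::
     tree_edges a i ++ tree_edges b (i + width a) ++ tree_edges d (i + width a + width b)).
  split.
  + by split; lia.
  + by move=> x; rewrite !(in_cons, mem_cat) !addnA; mem_cases.
  + by move=> x; rewrite !(in_cons, mem_cat) !addnA; mem_cases.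
  + by split; rewrite in_cons !mem_cat; apply/negP;
      move=> /or4P[/eqP[]|/tree_edges_bound[]|/tree_edges_bound[]|/tree_edges_bound[]];
      lia.
  + by split; rewrite !(in_cons, mem_cat) ?tree_edges_root ?eqxx ?orbT.
- have [p [q [r [s [S [[h1 h2 h3 h4 h5] E E' [n1 n2] [s1 s2 s3 s4]]]]]]] := IH i.
  have hb := width_gt0 b.
  exists p, q, r, s, ((i, i + (width a + width b)) :: S ++ tree_edges b (i + width a)).
  split.
  + by split; lia.
  + by move=> x; rewrite !(in_cons, mem_cat) E in_cons; mem_cases.
  + by move=> x; rewrite -(rotation_width R) !(in_cons, mem_cat) E' in_cons; mem_cases.
  + rewrite !(in_cons, mem_cat) (negPf n1) (negPf n2) /=.
    by split; apply/negP=> /orP[/eqP[]|/tree_edges_bound[]]; lia.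
  + by split; rewrite !(in_cons, mem_cat) ?s1 ?s2 ?s3 ?s4 ?orbT.
- have [p [q [r [s [S [[h1 h2 h3 h4 h5] E E' [n1 n2] [s1 s2 s3 s4]]]]]]] := IH (i + width a).
  have ha := width_gt0 a.
  exists p, q, r, s, ((i, i + (width a + width b)) :: tree_edges a i ++ S).
  split.
  + by split; lia.
  + move=> x; rewrite !(in_cons, mem_cat) E in_cons; mem_cases.
  + move=> x; rewrite -(rotation_width R) !(in_cons, mem_cat) E' in_cons; mem_cases.
  + rewrite !(in_cons, mem_cat) (negPf n1) (negPf n2) !orbF /=.
    by split; apply/negP=> /orP[/eqP[]|/tree_edges_bound[]]; lia.
  + by split; rewrite !(in_cons, mem_cat) ?s1 ?s2 ?s3 ?s4 ?orbT.
Qed.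

Inductive rotation_connected : tree -> tree -> Prop :=
| rc_refl t : rotation_connected t t
| rc_step t t' u : rotation t t' \/ rotation t' t ->
    rotation_connected t' u -> rotation_connected t u.

Lemma rc_trans t u v : rotation_connected t u -> rotation_connected u v ->
  rotation_connected t v.
Proof. by elim=> // {}t t' {}u R _ IH /IH; apply: rc_step. Qed.

Lemma rc_sym t u : rotation_connected t u -> rotation_connected u t.
Proof.
elim=> [t'|{}t t' {}u R _ IH]; first exact: rc_refl.
apply: (rc_trans IH); apply: rc_step (rc_refl _); tauto.
Qed.

Lemma rc_right a t u : rotation_connected t u ->
  rotation_connected (Node a t) (Node a u).
Proof.
elim=> [t'|{}t t' {}u R _ IH]; first exact: rc_refl.
apply: rc_step IH; case: R => R; [left|right]; exact: rotation_right.
Qed.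

Fixpoint comb k := if k is k'.+1 then Node Leaf (comb k') else Leaf.

Lemma rc_comb t : rotation_connected t (comb (width t).-1).
Proof.
have [k] := ubnP (width t); elim: k t => // k IH [|a b] le_k /=; first exact: rc_refl.
elim: a b le_k => [|a1 IH1 a2 _] b /= le_k.
  have hb := width_gt0 b.
  have := rc_right Leaf (IH b ltac:(lia)).
  by rewrite -[Node Leaf (comb _)]/(comb (width b).-1.+1) prednK.
(* A rotation at the root moves [a2] to the right; repeating it turns the left subtree into a leaf,
   after which the narrower right subtree is treated by induction on the width. *)
apply: rc_step; first by left; apply: rotation_root.
have := IH1 (Node a2 b); rewrite /= addnA; apply; lia.
Qed.

Lemma rc_width t u : width t = width u -> rotation_connected t u.
Proof.
by move=> E; apply: rc_trans (rc_comb t) _; rewrite E; apply: rc_sym (rc_comb u).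
Qed.

(** * Triangulations of a polygon with numbered vertices, given by trees *)

Section TreeTriangulation.
Variables (V : finType) (c : seq V) (pos : V -> nat) (vert : nat -> V) (lo m : nat).
Hypothesis pos_inj : injective pos.
Hypothesis clockwiseE : forall a x b y,
  clockwise c [:: a; x; b; y] = cyclic4 (pos a) (pos x) (pos b) (pos y).
Hypothesis mem_polygon : forall v, v \in c.
Hypothesis pos_bound : forall v, lo <= pos v <= lo + m.
Hypothesis vertK : forall p, lo <= p <= lo + m -> pos (vert p) = p.
Hypothesis boundary_pos : forall a b, pos a < pos b -> boundary_edge c [set a; b] ->
  (pos b == (pos a).+1) || (pos a == lo) && (pos b == lo + m).

Definition edge_set (s : seq (nat * nat)) : {set {set V}} :=
  [set e | [exists a, exists b, (e == [set a; b]) && ((pos a, pos b) \in s)]].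

Lemma mem_edge_set s a b : (forall p q, (p, q) \in s -> p < q) ->
  ([set a; b] \in edge_set s) = ((pos a, pos b) \in s) || ((pos b, pos a) \in s).
Proof.
move=> hs; rewrite inE; apply/idP/idP.
  case/existsP=> x /existsP[y /andP[]]; rewrite set2_inj.
  by case/orP=> /andP[/eqP-> /eqP->] ->; rewrite ?orbT.
case/orP=> H; apply/existsP.
  by exists a; apply/existsP; exists b; rewrite eqxx.
by exists b; apply/existsP; exists a; rewrite H setUC eqxx.
Qed.

Lemma mem_edge_set_lt s a b : (forall p q, (p, q) \in s -> p < q) ->
  pos a < pos b -> ([set a; b] \in edge_set s) = ((pos a, pos b) \in s).
Proof.
move=> hs ab; rewrite mem_edge_set //; case H: (_ \in s) => //=.
by apply/negP=> /hs; lia.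
Qed.

Lemma eq_edge_set s s' : s =i s' -> edge_set s = edge_set s'.
Proof.
move=> E; apply/setP=> e; rewrite !inE.
by apply: eq_existsb => a; apply: eq_existsb => b; rewrite E.
Qed.

Lemma edge_set_cons p q s : lo <= p <= lo + m -> lo <= q <= lo + m ->
  edge_set ((p, q) :: s) = [set vert p; vert q] |: edge_set s.
Proof.
move=> hp hq; apply/setP=> e; rewrite in_setU1 !inE; apply/idP/idP.
  case/existsP=> a /existsP[b /andP[/eqP-> ]]; rewrite inE => /orP[/eqP[Ep Eq]|H].
    by rewrite -Ep -Eq in hp hq *; rewrite !(pos_inj (vertK _)) ?eqxx.
  by apply/orP; right; apply/existsP; exists a; apply/existsP; exists b; rewrite eqxx.
case/orP=> [/eqP->|/existsP[a /existsP[b /andP[/eqP-> H]]]]; apply/existsP.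
  by exists (vert p); apply/existsP; exists (vert q); rewrite eqxx !vertK ?mem_head.
by exists a; apply/existsP; exists b; rewrite eqxx inE H orbT.
Qed.

Lemma edge_lt e : edge c e -> exists a b, e = [set a; b] /\ pos a < pos b.
Proof.
case/andP=> /cards2P[a [b [ab ->]]] _.
have [l|l|/pos_inj E] := ltngtP (pos a) (pos b); last by rewrite E eqxx in ab.
  by exists a, b.
by exists b, a; rewrite setUC.
Qed.

Lemma edge_set2 a b : a != b -> edge c [set a; b].
Proof.
by move=> ab; rewrite /edge cards2 ab; apply/subsetP=> x _; rewrite mem_polygon.
Qed.

Section OneTree.
Variable t : tree.
Hypothesis width_t : width t = m.

Let tlt p q : (p, q) \in tree_edges t lo -> p < q.
Proof. by case/tree_edges_bound. Qed.

Lemma noncrossing_tree : noncrossing c (edge_set (tree_edges t lo)).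
Proof.
apply/andP; split.
  apply/forall_inP=> e; rewrite inE => /existsP[a /existsP[b /andP[/eqP-> ]]].
  by move=> /tlt l; apply: edge_set2; apply/eqP=> E; rewrite E ltnn in l.
apply/forall_inP=> e He; apply/forall_inP=> f Hf; apply/negP.
move/(crosses_posP clockwiseE) => [a [b [x [y [H h1 h2]]]]].
have ab : pos a < pos b by lia.
have xy : pos x < pos y by lia.
case: H => -[E1 E2]; move: He Hf; rewrite E1 E2 !mem_edge_set_lt // => He Hf.
  exact: tree_edges_noncrossing He Hf h1 h2.
exact: tree_edges_noncrossing Hf He h1 h2.
Qed.

Lemma triangulation_tree : triangulation c (edge_set (tree_edges t lo)).
Proof.
apply/maxsetP; split=> [|B ncB sub]; first exact: noncrossing_tree.
apply/eqP; rewrite eqEsubset sub andbT; apply/subsetP=> e eB.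
have := ncB => /andP[/forall_inP/(_ e eB)/edge_lt[a [b [Ee ab]]] _].
rewrite Ee mem_edge_set_lt //.
have := pos_bound a; have := pos_bound b => hb ha.
case: (@tree_edges_maximal t lo (pos a) (pos b)) => //; try lia.
case=> r [s [rs H]]; exfalso.
have [h1 h2 h3] := tree_edges_bound rs.
have Pr : pos (vert r) = r by apply: vertK; lia.
have Ps : pos (vert s) = s by apply: vertK; lia.
have rsB : [set vert r; vert s] \in B.
  by apply: (subsetP sub); rewrite mem_edge_set_lt // ?Pr ?Ps.
have nc := noncrossing_pos clockwiseE ncB; rewrite Ee in eB.
case/orP: H => /andP[h4 h5].
  by apply: (nc _ _ _ _ eB rsB); rewrite ?Pr ?Ps.
by apply: (nc _ _ _ _ rsB eB); rewrite ?Ps ?Pr.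
Qed.

Lemma potential_tree w : potential pos w (edge_set (tree_edges t lo)) =
  \sum_(x <- tree_triangles t lo) w x.1.1 x.1.2 x.2.
Proof.
pose v3 (x : nat * nat * nat) := (vert x.1.1, vert x.1.2, vert x.2).
pose L := tree_triangles t lo.
have K x : x \in L -> (pos (vert x.1.1), pos (vert x.1.2), pos (vert x.2)) = x.
  case: x => [[p q] r] /tree_triangles_bound[/= h1 h2 h3 h4].
  by rewrite !vertK //; lia.
have U : uniq (map v3 L).
  rewrite map_inj_in_uniq ?tree_triangles_uniq // => x y /K Kx /K Ky [E1 E2 E3].
  by rewrite -Kx -Ky E1 E2 E3.
transitivity (\sum_(x <- map v3 L) w (pos x.1.1) (pos x.1.2) (pos x.2)).
  rewrite big_uniq //=; apply: eq_bigl => -[[a b] d]; rewrite /triangle /=.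
  apply/idP/mapP.
    case/and5P=> ab bd; rewrite !mem_edge_set_lt //; last by lia.
    move=> h1 h2 h3; exists (pos a, pos b, pos d).
      by rewrite /L -tree_trianglesP h1 h2 h3.
    by rewrite /v3 /=; congr (_, _, _); apply: pos_inj; rewrite vertK ?pos_bound.
  case=> -[[p q] r] xL [-> -> ->].
  have [/= h1 h2 h3 h4] := tree_triangles_bound xL.
  have [/= Ep Eq Er] := K _ xL.
  move: xL; rewrite /L -tree_trianglesP => /and3P[e1 e2 e3].
  by rewrite Ep Eq Er h2 h3 !mem_edge_set_lt ?Ep ?Eq ?Er ?e1 ?e2 ?e3 //; lia.
rewrite big_map; apply: eq_big_seq => x /K; rewrite /v3 /=.
by move=> E; rewrite -[in RHS]E.
Qed.

End OneTree.

Lemma rotation_flip t t' : width t = m -> rotation t t' ->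
  flip c (edge_set (tree_edges t lo)) (edge_set (tree_edges t' lo)) /\
  flip c (edge_set (tree_edges t' lo)) (edge_set (tree_edges t lo)).
Proof.
move=> wt R.
have [p [q [r [s [S [[h1 h2 h3 h4 h5] E E' [n1 n2] [s1 s2 s3 s4]]]]]]] := rotation_edges lo R.
have Slt x y : (x, y) \in S -> x < y.
  move=> H; suff : (x, y) \in tree_edges t lo by case/tree_edges_bound.
  by rewrite E inE H orbT.
have [Pp Pq Pr Ps] : [/\ pos (vert p) = p, pos (vert q) = q,
    pos (vert r) = r & pos (vert s) = s].
  by split; apply: vertK; lia.
have memS x y : pos (vert x) = x -> pos (vert y) = y -> x < y ->
    ([set vert x; vert y] \in edge_set S) = ((x, y) \in S).
  by move=> Ex Ey l; rewrite mem_edge_set_lt ?Ex ?Ey.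
have C (u v : V) : [set u; v] = [set v; u] by rewrite setUC.
have pr : p < r by lia.
have qs : q < s by lia.
have ps : p < s by lia.
rewrite !(eq_edge_set E) !(eq_edge_set E') !edge_set_cons; try lia.
have Epr : [set vert p; vert r] \notin edge_set S by rewrite memS.
have Eqs : [set vert q; vert s] \notin edge_set S by rewrite memS.
(* An edge with a vertex strictly between its ends is a side only if it joins the first vertex to
   the last. *)
have int x y z : pos (vert x) = x -> pos (vert y) = y ->
    x < z < y -> (lo < x) || (y < lo + m) ->
    interior_edge c [set vert x; vert y].
  move=> Px Py xzy hlo; apply/andP; split.
    by apply: edge_set2; apply/eqP=> /(congr1 pos); rewrite Px Py; lia.
  by apply/negP=> /boundary_pos; rewrite Px Py; lia.
split; apply/existsP.
  exists [set vert p; vert r]; apply/and3P; split; first by rewrite setU11.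
    by apply: (int _ _ q) => //; lia.
  apply/existsP; exists (vert p); apply/existsP; exists (vert q).
  apply/existsP; exists (vert r); apply/existsP; exists (vert s).
  rewrite clockwiseE Pp Pq Pr Ps eqxx setU1K // eqxx !andbT /=.
  apply/andP; split; first by rewrite /cyclic4; lia.
  apply/subsetP=> e He; rewrite in_setU1; apply/orP; right; move: He.
  by case/setUP=> [/setUP[/set2P[]|/set1P]|/set1P] ->; rewrite ?(C _ (vert p)) memS.
exists [set vert q; vert s]; apply/and3P; split; first by rewrite setU11.
  by apply: (int _ _ r) => //; lia.
apply/existsP; exists (vert q); apply/existsP; exists (vert r).
apply/existsP; exists (vert s); apply/existsP; exists (vert p).
rewrite clockwiseE Pp Pq Pr Ps eqxx setU1K // [[set vert r; vert p]]C eqxx !andbT /=.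
apply/andP; split; first by rewrite /cyclic4; lia.
apply/subsetP=> e He; rewrite in_setU1; apply/orP; right; move: He.
by case/setUP=> [/setUP[/set2P[]|/set1P]|/set1P] ->; rewrite ?(C _ (vert p)) memS.
Qed.

Lemma rotation_connected_path t t' : width t = m -> rotation_connected t t' ->
  exists p, flip_path c (edge_set (tree_edges t lo)) (edge_set (tree_edges t' lo)) p.
Proof.
move=> wt H; elim: H wt => [u|u u' u'' R _ IH] wu.
  by exists [::]; rewrite /flip_path /= triangulation_tree ?eqxx.
have [wu' fl] : width u' = m /\
    flip c (edge_set (tree_edges u lo)) (edge_set (tree_edges u' lo)).
  case: R => R; have := rotation_width R; rewrite wu => E; split=> //.
    by have [] := rotation_flip wu R.
  by have [] := rotation_flip E R.
have [p /and3P[h1 h2 h3]] := IH wu'.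
exists (edge_set (tree_edges u' lo) :: p).
by apply/and3P; split=> //=; [rewrite triangulation_tree|rewrite fl].
Qed.

End TreeTriangulation.

(** Paths of a fixed length form a finite type, so being the length of a path is a Boolean condition
    and has a least solution. *)
Lemma flip_distance_exists (V : finType) (c : seq V) T T' p :
  flip_path c T T' p -> exists d, flip_distance c T T' d.
Proof.
move=> pP.
have ex : exists k, [exists q : k.-tuple {set {set V}}, flip_path c T T' q].
  by exists (size p); apply/existsP; exists (in_tuple p).
exists (ex_minn ex); case: ex_minnP => k /existsP[q qP] kmin.
exists q; last by rewrite size_tuple.
split=> // r rP; rewrite size_tuple; apply: kmin.
by apply/existsP; exists (in_tuple r).
Qed.

(** * Regular polygons *)

(** Cutting the circle at [t] reverses a comparison exactly when [t] separates the two numbers, and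
    then the smaller one is the one below [t]. What remains is a Boolean verification. *)
Lemma cyclic4_rot t n d p q r s : p < n -> q < n -> r < n -> s < n ->
  let g x := d + (if x < t then x + n else x) in
  cyclic4 (g p) (g q) (g r) (g s) = cyclic4 p q r s.
Proof.
move=> hp hq hr hs g.
have ltg x y : x < n -> y < n -> (g x < g y) = (x < y) (+) ((x < t) (+) (y < t)) /\
    ((x < t) (+) (y < t)) ==> ((x < y) == (x < t)).
  by rewrite /g => hx hy; case: (ltnP x t) => ?; case: (ltnP y t) => ? /=; split => //; lia.
rewrite /cyclic4.
have [-> pq] := ltg _ _ hp hq; have [-> qr] := ltg _ _ hq hr.
have [-> rs] := ltg _ _ hr hs; have [-> sp] := ltg _ _ hs hp.
move: (p < t) (q < t) (r < t) (s < t) (p < q) (q < r) (r < s) (s < p) pq qr rs sp.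
by do 8!case.
Qed.

Section Ngon.
Variable n : nat.
Hypothesis n_gt1 : 1 < n.
Implicit Types u v : 'Z_n.

Lemma val_lt_ngon v : v < n.
Proof. by rewrite -[X in _ < X](Zp_cast n_gt1). Qed.

Lemma nat_ngon_eq (p q : nat) : (p%:R == q%:R :> 'Z_n)%R = (p == q %[mod n]).
Proof. by rewrite -val_eqE /= !val_Zp_nat. Qed.

Lemma mem_ngon v : v \in ngon n.
Proof.
apply/mapP; exists (v : nat); last by rewrite natr_Zp.
by rewrite mem_iota add0n val_lt_ngon.
Qed.

Lemma uniq_ngon : uniq (ngon n).
Proof.
rewrite map_inj_in_uniq ?iota_uniq // => p q; rewrite !mem_iota /= => hp hq.
by move/eqP; rewrite nat_ngon_eq !modn_small // => /eqP.
Qed.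

Lemma size_ngon : size (ngon n) = n.
Proof. by rewrite size_map size_iota. Qed.

Lemma nth_ngon v k : k < n -> nth v (ngon n) k = k%:R%R.
Proof. by move=> hk; rewrite (nth_map 0) ?size_iota // nth_iota. Qed.

Lemma index_ngon v : index v (ngon n) = v.
Proof.
rewrite -{1}(natr_Zp v) -(nth_ngon v (val_lt_ngon v)).
by rewrite index_uniq ?uniq_ngon ?size_ngon ?val_lt_ngon.
Qed.

Lemma next_ngon v : next (ngon n) v = (v + 1)%R.
Proof.
have E : ngon n = 0%R :: [seq k%:R%R | k <- iota 1 n.-1].
  by rewrite /ngon; have -> : iota 0 n = 0 :: iota 1 n.-1 by case: (n) n_gt1.
rewrite next_nth mem_ngon {1}E index_ngon.
have -> : (v + 1 = (v.+1)%:R)%R by rewrite -natr1 natr_Zp.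
have := val_lt_ngon v; rewrite leq_eqVlt => /orP[/eqP Ev|lt_v].
  rewrite nth_default ?Ev ?pchar_Zp // size_map size_iota; lia.
by rewrite (nth_map 0) ?size_iota ?nth_iota; try lia.
Qed.

Lemma boundary_ngonP (e : {set 'Z_n}) :
  reflect (exists v, e = [set v; v + 1]%R) (boundary_edge (ngon n) e).
Proof.
apply: (iffP exists_inP) => [[v _ /eqP->]|[v ->]].
  by exists v; rewrite next_ngon.
by exists v; rewrite ?mem_ngon ?next_ngon.
Qed.

Let key i (v : 'Z_n) := if v < i then v + n else v : nat.

Lemma map_key_rot i : i <= n -> map (key i) (rot i (ngon n)) = iota i n.
Proof.
move=> le_in.
apply: (@eq_from_nth _ 0); rewrite size_map size_rot size_ngon ?size_iota // => k lt_kn.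
rewrite (nth_map 0%R) ?size_rot ?size_ngon // nth_iota // /rot.
rewrite nth_cat size_drop size_ngon.
case: ltnP => hk.
  rewrite nth_drop nth_ngon; last by lia.
  by rewrite /key val_Zp_nat // modn_small; [case: ifP|]; lia.
rewrite nth_take; last by lia.
rewrite nth_ngon; last by lia.
by rewrite /key val_Zp_nat // modn_small; [case: ifP|]; lia.
Qed.

(** Read from the vertex [i] on, the polygon has the keys i, i + 1, ..., so its subsequences are the
    lists with increasing keys. *)
Lemma subseq_rot_ngon i (s : seq 'Z_n) : i <= n ->
  subseq s (rot i (ngon n)) = sorted (relpre (key i) ltn) s.
Proof.
move=> le_in; set r := relpre _ _.
have r_trans : transitive r by move=> u v x /=; apply: ltn_trans.
have r_irr : irreflexive r by move=> u /=; apply: ltnn.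
have r_rot : sorted r (rot i (ngon n)).
  by rewrite -sorted_map map_key_rot // iota_ltn_sorted.
apply/idP/idP => [sub|srt]; first exact: subseq_sorted r_trans _ _ sub r_rot.
suff -> : s = filter (mem s) (rot i (ngon n)) by apply: filter_subseq.
apply: (irr_sorted_eq r_trans r_irr) => //; first exact: sorted_filter.
by move=> x; rewrite mem_filter mem_rot mem_ngon andbT.
Qed.

Lemma clockwise_ngon (a x b y : 'Z_n) :
  clockwise (ngon n) [:: a; x; b; y] = cyclic4 a x b y.
Proof.
have [la lx lb ly] := And4 (val_lt_ngon a) (val_lt_ngon x) (val_lt_ngon b) (val_lt_ngon y).
apply/existsP/idP.
  case=> [[i /= lt_i]]; rewrite size_ngon in lt_i.
  rewrite subseq_rot_ngon ?(ltnW lt_i) //= /key /cyclic4.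
  by do ![case: ifP => ?]; lia.
move=> cyc.
have H k : k < n -> subseq [:: a; x; b; y] (rot k (ngon n)) ->
    exists i : 'I_(size (ngon n)), subseq [:: a; x; b; y] (rot i (ngon n)).
  by move=> lt_k Hk; rewrite -size_ngon in lt_k; exists (Ordinal lt_k).
apply: (H a) => //; rewrite subseq_rot_ngon ?(ltnW la) //= /key.
by move: cyc; rewrite /cyclic4; do ![case: ifP => ?]; lia.
Qed.

Variable h : nat.

(** The representative of [v] modulo n in [h + 1, h + n], which is x + n for the integer x in
    [h + 1 - n, h] numbering the vertex. *)
Definition position v : nat := h.+1 + (v - h.+1%:R)%R.

Definition vertex p : 'Z_n := p%:R%R.

Lemma position_bound v : h.+1 <= position v <= h.+1 + n.-1.
Proof. by have := val_lt_ngon (v - h.+1%:R)%R; rewrite /position; lia. Qed.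

Lemma positionK : cancel position vertex.
Proof. by move=> v; rewrite /vertex /position natrD natr_Zp addrC subrK. Qed.

Lemma position_inj : injective position. Proof. exact: can_inj positionK. Qed.

Lemma vertexK p : h.+1 <= p <= h.+1 + n.-1 -> position (vertex p) = p.
Proof.
move=> hp; rewrite /position /vertex -natrB; last by lia.
by rewrite val_Zp_nat // modn_small; lia.
Qed.

Lemma clockwise_position (a x b y : 'Z_n) : clockwise (ngon n) [:: a; x; b; y] =
  cyclic4 (position a) (position x) (position b) (position y).
Proof.
rewrite clockwise_ngon.
(* The largest multiple of n up to h + 1; positions then arise by cutting at h + 1 - d and
   translating by d. *)
pose d := h.+1 %/ n * n.
have d_le : d <= h.+1 by apply: leq_trunc_div.
have d_gt : h.+1 < d + n by rewrite addnC -mulSn ltn_ceil // ltnW.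
have posE v : position v = d + (if v < h.+1 - d then v + n else v).
  have lt_v := val_lt_ngon v; case: ltnP => hv.
    rewrite -[RHS]vertexK; last by lia.
    by rewrite /vertex !natrD natrM pchar_Zp // mulr0 add0r addr0 natr_Zp.
  rewrite -[RHS]vertexK; last by lia.
  by rewrite /vertex natrD natrM pchar_Zp // mulr0 add0r natr_Zp.
by rewrite !posE cyclic4_rot ?val_lt_ngon.
Qed.

Lemma boundary_position (a b : 'Z_n) : position a < position b ->
  boundary_edge (ngon n) [set a; b] ->
  (position b == (position a).+1) ||
  (position a == h.+1) && (position b == h.+1 + n.-1).
Proof.
have S v : position (v + 1)%R = if position v == h.+1 + n.-1 then h.+1 else (position v).+1.
  have hb := position_bound v.
  have -> : (v + 1 = vertex (position v).+1)%R.
    by rewrite /vertex -natr1 -[((position v)%:R)%R]/(vertex _) positionK.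
  case: eqP => [->|ne]; last by rewrite vertexK //; lia.
  have -> : (h.+1 + n.-1).+1 = h.+1 + n by lia.
  by rewrite /vertex natrD pchar_Zp // addr0 vertexK //; lia.
move=> ab /boundary_ngonP[v /eqP]; rewrite set2_inj.
by case/orP=> /andP[/eqP Ea /eqP Eb]; move: ab; rewrite Ea Eb S; case: eqP => ?; lia.
Qed.

End Ngon.

(** * Deletion of vertices *)

Lemma next_rem (V : eqType) (c : seq V) (a x : V) : uniq c -> x \in c -> a \in c -> x != a ->
  next (rem a c) x = if next c x == a then next c a else next c x.
Proof.
move=> c_uniq xc ac xa.
have [i s Ec] := rot_to xc.
have uR : uniq (x :: s) by rewrite -Ec rot_uniq.
have -> : next (rem a c) x = next (rem a (x :: s)) x.
  rewrite !rem_filter // -Ec; set P := predC1 a.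
  have -> : filter P (rot i c) = rot (size (filter P (take i c))) (filter P c).
    by rewrite -[X in rot _ (filter P X)](cat_take_drop i c) !filter_cat rot_size_cat.
  by rewrite next_rot // filter_uniq.
rewrite -!(next_rot i c_uniq) Ec.
have as' : a \in s by move: ac; rewrite -(mem_rot i) Ec inE eq_sym (negPf xa).
case: s as' {Ec uR} => // y s ays.
rewrite /= !eqxx (eq_sym a x) !(negPf xa).
case: eqP => [->|ya]; rewrite ?eqxx /=; last by rewrite eqxx.
by case: s {ays} => [|z s] /=; rewrite !eqxx.
Qed.

Lemma imset_set2 (U W : finType) (f : U -> W) x y : f @: [set x; y] = [set f x; f y].
Proof. by rewrite imsetU1 imset_set1. Qed.

Section Deletion.
Variables (V : finType) (c0 : seq V) (T0 : {set {set V}}).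
Hypothesis card_T0 : forall e, e \in T0 -> #|e| = 2.

Definition collapse (c : seq V) a x := if x == a then next c a else x.

Definition pushforward (W : finType) (f : V -> W) (T : {set {set V}}) :=
  [set f @: e | e : {set V} in T & #|f @: e| == 2].

(* [rho] sends every vertex of the initial polygon to the vertex of the
    current polygon with which it has been identified. *)
Record collapsed (c : seq V) (T : {set {set V}}) (rho : V -> V) : Prop := Collapsed {
  collapsed_uniq : uniq c;
  collapsed_mem : forall x, rho x \in c;
  collapsed_id : forall x, x \in c -> rho x = x;
  collapsed_next : forall x, x \in c -> next c x = rho (next c0 x);
  collapsed_out : forall x, x \notin c -> rho x = rho (next c0 x);
  collapsed_set : T = pushforward rho T0 }.

(** The edge from [a] to its successor is the only one that shrinks to a point when these two
    vertices are merged. *)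
Lemma delete_vertexE (c : seq V) (T : {set {set V}}) a :
  (forall e, e \in T -> #|e| = 2) -> next c a != a ->
  delete_vertex c T a = pushforward (collapse c a) T.
Proof.
move=> cT na.
have K e : e \in T -> (e != [set a; next c a]) = (#|collapse c a @: e| == 2).
  move=> eT; have /eqP/cards2P[x [y [xy ->]]] := cT _ eT.
  rewrite imset_set2 cards2 set2_inj /collapse.
  have [Ex|xa] := eqVneq x a; have [Ey|ya] := eqVneq y a; rewrite ?andbF ?andbT ?orbF //=.
  - by rewrite Ex Ey eqxx in xy.
  - by rewrite eq_sym; case: (_ == _).
  - by case: (_ == _).
  - by rewrite xy.
apply/setP=> f; apply/imsetP/imsetP => -[e]; rewrite !inE => /andP[].
  by move=> ne eT ->; exists e; rewrite ?inE ?eT ?K // -K.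
by move=> eT ce ->; exists e; rewrite ?inE ?eT ?K // ce.
Qed.

(** Successive deletions thus amount to one map. Cardinals of images do not increase, so an edge
    with a two-element final image has a two-element intermediate image. *)
Lemma pushforward_comp (W : finType) (f : V -> V) (g : V -> W) :
  [set g @: e | e : {set V} in pushforward f T0 & #|g @: e| == 2] = pushforward (g \o f) T0.
Proof.
apply/setP=> e; apply/imsetP/imsetP => [[e1]|[e1]].
  rewrite inE => /andP[/imsetP[e2]]; rewrite inE => /andP[e2T _] -> ce ->.
  by exists e2; rewrite ?inE ?e2T imset_comp.
rewrite inE => /andP[e1T]; rewrite imset_comp => ce ->.
exists (f @: e1) => //; rewrite inE ce andbT.
apply/imsetP; exists e1 => //; rewrite inE e1T /= eqn_leq -{1}(card_T0 e1T) leq_imset_card /=.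
by rewrite -(eqP ce) leq_imset_card.
Qed.

Lemma collapsed_delete c T rho a : collapsed c T rho -> a \in c -> 1 < size c ->
  collapsed (rem a c) (delete_vertex c T a) (collapse c a \o rho).
Proof.
case=> cu cm cid cn co cT ac sc.
have na : next c a != a.
  have [i [|b s] Ec] := rot_to ac.
    by move: sc; rewrite -(size_rot i) Ec.
  rewrite -(next_rot i cu) Ec /= eqxx; apply: contraTneq cu => E.
  by rewrite -(rot_uniq i) Ec E /= inE eqxx.
have nac : next c a \in c by rewrite mem_next.
split.
- by rewrite rem_uniq.
- move=> x /=; rewrite mem_rem_uniq // !inE /collapse.
  by have [_|->] := eqVneq (rho x) a; rewrite ?na ?nac ?cm.
- by move=> x; rewrite mem_rem_uniq // !inE /collapse /= => /andP[/negPf xa /cid->]; rewrite xa.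
- move=> x; rewrite mem_rem_uniq // !inE => /andP[xa xc] /=.
  by rewrite next_rem // /collapse -cn.
- move=> x; rewrite mem_rem_uniq // !inE negb_and negbK /=.
  have [->|xa] /= := eqVneq x a; last by move=> xc; rewrite (co _ xc).
  by move=> _; rewrite /= cid // -cn // /collapse eqxx (negPf na).
- rewrite delete_vertexE //.
    by rewrite cT; apply: pushforward_comp.
  by rewrite cT => e /imsetP[e']; rewrite inE => /andP[_ /eqP ce] ->.
Qed.

Lemma collapsed_deletes s c T rho : collapsed c T rho -> uniq s -> {subset s <= c} ->
  size s < size c -> exists rho',
    [/\ collapsed (deletes (c, T) s).1 (deletes (c, T) s).2 rho',
        size (deletes (c, T) s).1 = size c - size s &
        forall x, (x \in (deletes (c, T) s).1) = (x \in c) && (x \notin s)].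
Proof.
elim: s c T rho => [|a s IH] c T rho H.
  by move=> _ _ _; exists rho; split; rewrite ?subn0 // => x; rewrite andbT.
rewrite /deletes /= -/(deletes _ _) => /andP[as_ us] sub ss.
have ac : a \in c by apply: sub; rewrite mem_head.
have cu := collapsed_uniq H.
have := collapsed_delete H ac ltac:(lia).
case/IH => //.
- move=> x xs; rewrite mem_rem_uniq // !inE sub ?inE ?xs ?orbT // andbT.
  by apply: contraNneq as_ => <-.
- by rewrite size_rem // ltn_predRL.
move=> rho' [H1 H2 H3]; exists rho'; split=> //.
  by rewrite H2 size_rem // -subn1 -subnDA add1n.
by move=> x; rewrite H3 mem_rem_uniq // !inE negb_or; case: (x == a); rewrite ?andbF.
Qed.

End Deletion.

Lemma index_next (V : eqType) (c : seq V) x : uniq c -> x \in c ->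
  index (next c x) c = (index x c).+1 %% size c.
Proof.
case: c => // y p cu xc; rewrite next_nth xc.
have := xc; rewrite -index_mem; set i := index x _ => lt_i.
have -> : nth y p i = nth y (y :: p) i.+1 by [].
have [lt_ip|ge_ip] := ltnP i (size p); first by rewrite index_uniq // modn_small.
have -> : i = size p by apply/eqP; rewrite eqn_leq ge_ip -ltnS lt_i.
by rewrite nth_default // modnn /= eqxx.
Qed.

(** * Deletions followed by relabelling as a single map *)

Section Relabel.
Variables (N n : nat) (s : seq 'Z_N) (v : 'Z_N) (l : 'Z_n) (T0 : {set {set 'Z_N}}).
Hypotheses (N_gt1 : 1 < N) (n_gt1 : 1 < n) (s_uniq : uniq s) (size_s : n + size s = N).
Hypothesis v_s : v \notin s.
Hypothesis card_T0 : forall e, e \in T0 -> #|e| = 2.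

(** Going clockwise, [psi] advances by one at a kept vertex and stays at a deleted one, because a
    deleted vertex is merged with its successor. Together with the value at [v] this determines
    [psi]. *)
Lemma relabel_deletes : exists psi : 'Z_N -> 'Z_n,
  [/\ relabel v l (deletes (ngon N, T0) s) = pushforward psi T0,
      psi v = l,
      forall t, psi (t + 1)%R = (psi t + (t \notin s)%:R)%R &
      forall u, exists2 t, t \notin s & psi t = u].
Proof.
have T0E : T0 = pushforward id T0.
  apply/setP=> e; apply/idP/imsetP => [eT|[e']].
    by exists e; rewrite ?imset_id // inE eT imset_id card_T0.
  by rewrite inE imset_id => /andP[eT _] ->.
have H0 : collapsed (ngon N) T0 (ngon N) T0 id.
  by split=> // [|x|x]; rewrite ?uniq_ngon ?mem_ngon.
have [x _||rho [[cu cm cid cn co cT] sc mc]] := collapsed_deletes card_T0 H0 s_uniq.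
- by rewrite mem_ngon.
- by rewrite size_ngon -[X in _ < X]size_s -[X in X < _]add0n ltn_add2r ltnW.
move: cu cm cid cn co cT sc mc; rewrite /relabel.
set c := (deletes _ _).1; set T := (deletes _ _).2 => cu cm cid cn co cT sc mc.
have {}sc : size c = n by rewrite sc size_ngon -[X in X - _]size_s addnK.
have vc : v \in c by rewrite mc mem_ngon.
pose c' := rot (index v c) c.
have cu' : uniq c' by rewrite rot_uniq.
have sc' : size c' = n by rewrite size_rot.
have mc' x : (x \in c') = (x \in c) by rewrite mem_rot.
pose label x : 'Z_n := (l + (index x c')%:R)%R.
have label_inj : {in c &, injective label}.
  move=> x y xc yc /addrI /eqP; rewrite nat_ngon_eq // -{1 2}sc'.
  rewrite !modn_small ?index_mem ?mc' // => /eqP E.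
  by rewrite -(nth_index x (_ : x \in c')) ?mc' // E nth_index // mc'.
have label_next x : x \in c -> label (next c x) = (label x + 1)%R.
  move=> xc; rewrite /label -(next_rot (index v c) cu) index_next ?mc' //.
  rewrite -addrA natr1; congr (_ + _)%R; apply/eqP.
  by rewrite nat_ngon_eq // sc' modn_mod.
exists (label \o rho); split.
- rewrite -/(pushforward _ _) -pushforward_comp // -cT.
  apply/setP=> e; apply/imsetP/imsetP => [[e' eT] ->|[e']]; last first.
    by rewrite inE => /andP[eT _] ->; exists e'.
  exists e' => //; rewrite inE eT /=.
  move: (eT); rewrite cT => /imsetP[e0]; rewrite inE => /andP[_ /eqP ce] Ee.
  have e'c z : z \in e' -> z \in c by rewrite Ee => /imsetP[y _ ->].
  have ce' : #|e'| == 2 by rewrite Ee ce.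
  by rewrite card_in_imset // => x y xe ye; exact: label_inj (e'c _ xe) (e'c _ ye).
- rewrite /= cid // /label /c'.
  have -> : index v (rot (index v c) c) = 0.
    by rewrite /rot (drop_nth v) ?index_mem // nth_index //= eqxx.
  by rewrite addr0.
- move=> t /=; have := mc t; rewrite mem_ngon //= => Et.
  have [ts|ts] := boolP (t \in s).
    by rewrite -next_ngon // -co ?Et ?ts // addr0.
  have tc : t \in c by rewrite Et.
  by rewrite -next_ngon // -cn // label_next // cid.
- move=> u; pose x := nth v c' (u - l)%R.
  have lt : (u - l)%R < size c' by rewrite sc' val_lt_ngon.
  have xc : x \in c by rewrite -mc' mem_nth.
  exists x; first by move: xc; rewrite mc => /andP[].
  by rewrite /= cid // /label index_uniq // natr_Zp addrC subrK.
Qed.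

End Relabel.

(** * Caterpillars *)

Section Caterpillar.
Variable left : nat -> nat -> bool.

(** The interval [i, i + k + 1] is peeled one vertex at a time; [left p q] tells whether the
    remaining interval [p, q] loses its left end. *)
Fixpoint caterpillar k i :=
  if k is k'.+1 then
    if left i (i + k.+1) then Node Leaf (caterpillar k' i.+1)
    else Node (caterpillar k' i) Leaf
  else Leaf.

Lemma width_caterpillar k i : width (caterpillar k i) = k.+1.
Proof. by elim: k i => //= k IH i; case: ifP => _ /=; rewrite IH; lia. Qed.

(** [C] describes the edges other than sides. The hypotheses say that a vertex about to be cut off
    has no shorter [C]-edge except possibly to its neighbour, and that the edge cutting it off is
    again in [C]. *)
Lemma caterpillar_edges (C : nat -> nat -> bool) k i :
  (forall p q, C p q -> p.+1 < q -> left p q ->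
     C p.+1 q /\ forall r, p < r < q -> C p r -> r = p.+1) ->
  (forall p q, C p q -> p.+1 < q -> ~~ left p q ->
     C p q.-1 /\ forall r, p < r < q -> C r q -> r.+1 = q) ->
  C i (i + k.+1) ->
  forall p q, i <= p -> p < q -> q <= i + k.+1 ->
    ((p, q) \in tree_edges (caterpillar k i) i) = (q == p.+1) || C p q.
Proof.
move=> Hl Hr; elim: k i => [|k IH] i Ci p q ip pq qi.
  have [-> ->] : p = i /\ q = i.+1 by lia.
  by rewrite /= inE addn1 !eqxx.
rewrite [caterpillar _ _]/=; case: ifP => L.
  have [C' only] := Hl _ _ Ci ltac:(lia) L.
  rewrite [tree_edges _ _]/= width_caterpillar !inE (addn1 i) add1n.
  have [->|ne] := eqVneq p i.
    have -> : ((i, q) \in tree_edges (caterpillar k i.+1) i.+1) = false.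
      by apply/negP=> /tree_edges_bound[]; lia.
    rewrite orbF !xpair_eqE eqxx /= orbC.
    have [//|q_ne] := eqVneq q i.+1; rewrite /=.
    have [->|q_ne'] := eqVneq q (i + k.+2); first by rewrite Ci.
    by apply/esym/negP=> Cq; have := only q ltac:(lia) Cq; lia.
  rewrite !xpair_eqE (negPf ne) /= IH; try lia.
  by rewrite addSnnS.
have [C' only] := Hr _ _ Ci ltac:(lia) (negbT L).
have E : (i + k.+2).-1 = i + k.+1 by lia.
rewrite E in C'.
rewrite [tree_edges _ _]/= width_caterpillar in_cons mem_cat inE addn1.
have [->|ne] := eqVneq q (i + k.+2).
  have -> : ((p, i + k.+2) \in tree_edges (caterpillar k i) i) = false.
    by apply/negP=> /tree_edges_bound[]; rewrite width_caterpillar; lia.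
  rewrite !xpair_eqE !eqxx /= !andbT.
  have [->|p_ne] := eqVneq p i; first by rewrite Ci orbT.
  have [->|p_ne'] := eqVneq p (i + k.+1).
    by rewrite !addnS ?addn0 !eqxx ?orbT.
  rewrite /= ; apply/esym/negP=> /orP[/eqP|Cp]; first by lia.
  by have := only p ltac:(lia) Cp; lia.
have -> : ((p, q) == (i + k.+1, i + k.+1 + 1)) = false by rewrite xpair_eqE; lia.
by rewrite xpair_eqE (negPf ne) andbF orbF /=; apply: IH => //; lia.
Qed.

Variable w : nat -> nat -> nat -> nat.

Fixpoint caterpillar_sum k i :=
  if k is k'.+1 then
    if left i (i + k.+1) then w i i.+1 (i + k.+1) + caterpillar_sum k' i.+1
    else w i (i + k) (i + k.+1) + caterpillar_sum k' i
  else 0.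

Lemma caterpillar_sumE k i :
  \sum_(x <- tree_triangles (caterpillar k i) i) w x.1.1 x.1.2 x.2 = caterpillar_sum k i.
Proof.
elim: k i => [|k IH] i; first by rewrite big_nil.
rewrite [caterpillar _ _]/= [RHS]/=; case: ifP => L.
  rewrite [tree_triangles _ _]/= big_cons width_caterpillar /= add1n addn1.
  by rewrite IH.
rewrite [tree_triangles _ _]/= cats0 big_cons width_caterpillar /= addn1.
by rewrite IH.
Qed.

Lemma caterpillar_sum_left k i j : j = i + k.+2 -> left i j ->
  caterpillar_sum k.+1 i = w i i.+1 j + caterpillar_sum k i.+1.
Proof. by move=> -> /= ->. Qed.

Lemma caterpillar_sum_right k i j : j.+1 = i + k.+2 -> ~~ left i j.+1 ->
  caterpillar_sum k.+1 i = w i j j.+1 + caterpillar_sum k i.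
Proof.
move=> Ej /=; rewrite -Ej => /negPf ->; congr (w _ _ _ + _); lia.
Qed.

End Caterpillar.

(** Turns equality of vertex labels into linear arithmetic. *)
Lemma eqmod_lt N t k : t < 2 * N -> k < 2 * N ->
  (t == k %[mod N]) = [|| t == k, t == k + N | k == t + N].
Proof.
move=> ht hk.
have M x : x < 2 * N -> x %% N = if x < N then x else x - N.
  move=> hx; case: ltnP => hN; first exact: modn_small.
  by rewrite -{1}(subnK hN) modnDr modn_small; lia.
by rewrite !M //; do 2!case: ltnP => ?; lia.
Qed.

(** * The triangulations of A_n *)

Section Zigzag.
Variables (n N h : nat).
Hypotheses (n_ge3 : 3 <= n) (NE : N = n + 4) (hE : h = N./2).

Let n_gt1 : 1 < n. Proof. by lia. Qed.
Let N_gt1 : 1 < N. Proof. by rewrite NE; lia. Qed.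

(** The end 2 - k or 1 - k of the zigzag edge, raised by N so that all ends used lie in
    [2, N + 2]. *)
Definition zigzag_left i := N + 2 - i./2 - odd i.
Definition zigzag_right i := 4 + i./2.

Lemma zigzag_edgeE i : i < N - 3 ->
  zigzag_edge N i = [set (zigzag_left i)%:R; (zigzag_right i)%:R]%R.
Proof.
move=> lt_i; rewrite /zigzag_edge /zigzag_left /zigzag_right natrD.
have N0 : (N%:R = 0 :> 'Z_N)%R by rewrite pchar_Zp.
have B k : ((N + k - i./2)%:R = k%:R - (i./2)%:R :> 'Z_N)%R.
  by rewrite natrB ?natrD ?N0 ?add0r //; lia.
case: (odd i); last by rewrite subn0 B.
have -> : N + 2 - i./2 - true = N + 1 - i./2 by rewrite /=; lia.
by rewrite B.
Qed.

Lemma card_zigzag e : e \in zigzag N -> #|e| = 2.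
Proof.
case/setUP=> [|/imsetP[i _ ->]].
  rewrite inE => /(boundary_ngonP N_gt1)[v ->]; rewrite cards2.
  rewrite (_ : v != _) //; rewrite -subr_eq0 opprD addrA subrr add0r oppr_eq0.
  by rewrite oner_eq0.
have lt_i := ltn_ord i.
rewrite zigzag_edgeE // cards2 nat_ngon_eq // eqmod_lt; rewrite /zigzag_left /zigzag_right.
- by rewrite (_ : ~~ _) //; move: lt_i NE; lia.
- by move: lt_i NE; lia.
- by move: lt_i NE; lia.
Qed.

(** * The image of the zigzag, with a lift [g] of [psi] to the integers *)

Section Image.
Variables (s : seq 'Z_N) (psi : 'Z_N -> 'Z_n) (g : nat -> nat).
Hypothesis psi_succ : forall t, psi (t + 1)%R = (psi t + (t \notin s)%:R)%R.
Hypothesis psi_onto : forall u, exists2 t, t \notin s & psi t = u.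
Hypothesis psi_2 : psi 2%:R%R = (g 2)%:R%R.
Hypothesis g_succ : forall t, 2 <= t < N + 2 -> g t.+1 = g t + ((t%:R)%R \notin s).
Hypothesis g_left : forall i, i < N - 3 -> h < g (zigzag_left i) <= n + 2.
Hypothesis g_right : forall i, i < N - 3 -> 3 <= g (zigzag_right i) <= h.

Let pos := @position n h.

Lemma psi_nat t : 2 <= t <= N + 2 -> psi t%:R%R = (g t)%:R%R.
Proof.
case/andP; elim: t => // t IH; rewrite leq_eqVlt => /orP[/eqP[<-] // |le2] leN.
by rewrite -natr1 psi_succ IH // ?g_succ ?natrD //; lia.
Qed.

Lemma mem_image a b : pos a < pos b ->
  reflect ((pos b = (pos a).+1 \/ pos a = h.+1 /\ pos b = h + n) \/
           exists i, [/\ i < N - 3, pos a = g (zigzag_left i) &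
                         pos b = n + g (zigzag_right i)])
    ([set a; b] \in pushforward psi (zigzag N)).
Proof.
have vK := vertexK n_gt1.
have img i : i < N - 3 -> psi @: zigzag_edge N i =
    [set vertex n (g (zigzag_left i)); vertex n (n + g (zigzag_right i))] /\
    (pos (vertex n (g (zigzag_left i))) = g (zigzag_left i) /\
    pos (vertex n (n + g (zigzag_right i))) = n + g (zigzag_right i)).
  move=> lt_i; have := g_left lt_i; have := g_right lt_i => hr hl; split.
    rewrite zigzag_edgeE // imset_set2 !psi_nat /zigzag_left /zigzag_right.
    - by rewrite /vertex natrD pchar_Zp // add0r.
    - by move: lt_i NE; lia.
    - by move: lt_i NE; lia.
  by rewrite /pos !vK //; move: hE NE; lia.
move=> ab; apply: (iffP imsetP).
  case=> e; rewrite inE => /andP[/setUP[bd|/imsetP[i _ ->]] ce Eab].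
    move: bd; rewrite inE => /(boundary_ngonP N_gt1)[v Ev]; left.
    have : boundary_edge (ngon n) [set a; b].
      apply/(boundary_ngonP n_gt1); exists (psi v).
      move: Eab ce; rewrite Ev imset_set2 psi_succ.
      (* If [v] is deleted, its side collapses to a point and is discarded. *)
      by case: (v \in s) => //=; rewrite addr0 setUid cards1.
    move/(boundary_position n_gt1 ab)/orP => [/eqP|/andP[/eqP ? /eqP ?]]; first by left.
    by right; split=> //; rewrite /pos; lia.
  right; exists i; split; first exact: ltn_ord.
    have [Ei [p1 p2]] := img i (ltn_ord i); move/eqP: Eab; rewrite Ei set2_inj.
    have := g_left (ltn_ord i); have := g_right (ltn_ord i) => hr hl.
    case/orP=> /andP[/eqP Ea /eqP Eb]; first by rewrite Ea.
    by move: ab; rewrite Ea Eb p1 p2; move: hE NE; lia.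
  have [Ei [p1 p2]] := img i (ltn_ord i); move/eqP: Eab; rewrite Ei set2_inj.
  have := g_left (ltn_ord i); have := g_right (ltn_ord i) => hr hl.
  case/orP=> /andP[/eqP Ea /eqP Eb]; first by rewrite Eb.
  by move: ab; rewrite Ea Eb p1 p2; move: hE NE; lia.
have a_ne_b : a != b by apply: contraTneq ab => ->; rewrite ltnn.
case=> [bd|[i [lt_i Ea Eb]]].
  have [u Eu] : exists u, [set a; b] = [set u; (u + 1)%R].
    have Va : ((pos a)%:R = a)%R := @positionK n h a.
    have Vb : ((pos b)%:R = b)%R := @positionK n h b.
    case: bd => [Eb|[Ea Eb]]; first by exists a; rewrite -Vb Eb -natr1 Va.
    (* The closing side: modulo n, the position h + n is followed by h + 1. *)
    exists b; rewrite setUC; congr [set _; _].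
    by rewrite -Va Ea -Vb Eb natr1 -addSn natrD pchar_Zp // addr0.
  have [v vs Ev] := psi_onto u.
  exists [set v; v + 1]%R; last by rewrite imset_set2 psi_succ vs Ev.
  rewrite !inE imset_set2 psi_succ vs Ev -Eu cards2 a_ne_b andbT.
  by apply/orP; left; apply/(boundary_ngonP N_gt1); exists v.
have [Ei [p1 p2]] := img i lt_i.
have E : [set a; b] = psi @: zigzag_edge N i.
  rewrite Ei; congr [set _; _]; apply: (@position_inj n h);
  by rewrite -/pos ?p1 ?p2.
exists (zigzag_edge N i) => //; rewrite inE -E cards2 a_ne_b andbT.
by apply/setUP; right; apply/imsetP; exists (Ordinal lt_i).
Qed.

Lemma image_eq_caterpillar (left C : nat -> nat -> bool) :
  (forall p q, C p q -> p.+1 < q -> left p q ->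
     C p.+1 q /\ forall r, p < r < q -> C p r -> r = p.+1) ->
  (forall p q, C p q -> p.+1 < q -> ~~ left p q ->
     C p q.-1 /\ forall r, p < r < q -> C r q -> r.+1 = q) ->
  C h.+1 (h + n) ->
  (forall i, i < N - 3 -> C (g (zigzag_left i)) (n + g (zigzag_right i))) ->
  (forall p q, h < p -> p.+1 < q -> q <= h + n -> C p q -> (p == h.+1) && (q == h + n) \/
     exists i, [/\ i < N - 3, p = g (zigzag_left i) & q = n + g (zigzag_right i)]) ->
  pushforward psi (zigzag N) =
  edge_set pos (tree_edges (caterpillar left (n - 2) h.+1) h.+1).
Proof.
move=> Hl Hr Croot Cimg Cpre.
have En : h.+1 + (n - 2).+1 = h + n by lia.
have tlt p q : (p, q) \in tree_edges (caterpillar left (n - 2) h.+1) h.+1 -> p < q.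
  by case/tree_edges_bound.
have main a b : pos a < pos b -> ([set a; b] \in pushforward psi (zigzag N)) =
    ([set a; b] \in edge_set pos (tree_edges (caterpillar left (n - 2) h.+1) h.+1)).
  move=> ab; rewrite mem_edge_set_lt //.
  have := position_bound n_gt1 h a; have := position_bound n_gt1 h b; rewrite -/pos => hb ha.
  rewrite (caterpillar_edges Hl Hr) ?En; try lia; rewrite // -/pos.
  apply/(mem_image ab)/idP.
    case=> [[->|[-> ->]]|[i [lt_i -> ->]]]; rewrite ?eqxx ?Croot ?orbT //.
    by rewrite Cimg ?orbT.
  case/orP=> [/eqP|CC]; first by left; left.
  have [Eb|ne] := eqVneq (pos b) (pos a).+1; first by left; left.
  have ltab : (pos a).+1 < pos b by rewrite ltn_neqAle eq_sym ne.
  have leb : pos b <= h + n by lia.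
  have lta : h < pos a by lia.
  have [] := Cpre (pos a) (pos b) lta ltab leb CC; last by right.
    by case/andP=> /eqP Ea /eqP Eb; left; right.
apply/setP=> e; apply/idP/idP => He.
  have ce : #|e| == 2 by move: He => /imsetP[e0]; rewrite inE => /andP[_ ce] ->.
  have /cards2P[a [b [ne Ee]]] := ce; rewrite Ee in He *.
  have [l|l|/(@position_inj n h) E] := ltngtP (pos a) (pos b).
  - by rewrite -main.
  - by rewrite setUC -main // setUC.
  - by rewrite E eqxx in ne.
have := He; rewrite inE => /existsP[a /existsP[b /andP[/eqP Ee /tlt ab]]].
by rewrite Ee main // -Ee.
Qed.

End Image.

(* The deletions identify every vertex t in [2, N + 2] of the (n + 4)-gon (read
   modulo N) with a vertex of the n-gon, whose label is [collapse_minus t] or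
   [collapse_plus t] modulo n. *)
Definition collapse_minus t :=
  if t <= h then t else if t <= h + 2 then h else minn (t - 2) (n + 2).

Definition collapse_plus t :=
  if t <= 3 then t - 1 else if t <= 6 then 3 else if t <= h + 4 then t - 3
  else if t <= h + 6 then h + 1 else t - 5.

(** A zigzag with sums 7 and 8, continued by a fan at the vertex 2 at one end and by a fan at the
    vertex h at the other. *)
Definition edge_minus p q := [&& p <= n + 2, n + 3 <= q <= h + n &
  [|| 2 * n + 7 <= p + q <= 2 * n + 8,
      (p == n + 2) && (p + q <= 2 * n + 8) |
      (q == h + n) && (p + q <= 2 * n + 8)]].

(** A zigzag with sums 1 and 2, continued by fans at the vertices 3 and h + 1 - n. *)
Definition edge_plus p q := [&& h < p <= n + 2, n + 3 <= q &
  [|| 2 * n + 1 <= p + q <= 2 * n + 2,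
      (q == n + 3) && (2 * n + 1 <= p + q) |
      (p == h.+1) && (2 * n + 1 <= p + q)]].

(* Removing the triangles of A_n^- and A_n^+ one by one from the bottom side
   {h + 1 - n, h}, the remaining polygon is always an interval of vertices; the
   next triangle to go cuts off its left or its right end. *)
Definition left_minus p q := (p < n + 2) && (p + q <= 2 * n + 7).
Definition left_plus p q := (q == n + 3) || (p + q <= 2 * n + 1).

Let natE (t k : nat) : t < 2 * N -> k < 2 * N ->
  (t%:R == k%:R :> 'Z_N)%R = [|| t == k, t == k + N | k == t + N].
Proof. by move=> ht hk; rewrite nat_ngon_eq // eqmod_lt. Qed.

Lemma zigzag_preimage (g : nat -> nat) p q x y :
  N + 5 <= x + y <= N + 6 -> 4 <= y -> y + 2 <= x -> p = g x -> q = n + g y -> exists i,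
    [/\ i < N - 3, p = g (zigzag_left i) & q = n + g (zigzag_right i)].
Proof.
(* The ends of a zigzag edge add up to N + 6 for even i and to N + 5 for odd i, and its right end
   gives the half of i. *)
move=> hxy hy hyx -> ->; exists (N + 6 - (x + y) + 2 * (y - 4)).
rewrite /zigzag_left /zigzag_right; split; [lia|congr g; lia|congr (n + g _); lia].
Qed.

Lemma relabel_minus :
  relabel (2 : 'Z_N)%R (2 : 'Z_n)%R
    (deletes (ngon N, zigzag N) [:: 0%:R; 1%:R; h%:R; (1 + h)%:R]%R) =
  edge_set (@position n h)
    (tree_edges (caterpillar left_minus (n - 2) h.+1) h.+1).
Proof.
have [] := @relabel_deletes N n [:: 0%:R; 1%:R; h%:R; (1 + h)%:R]%R 2%:R%R 2%:R%R (zigzag N).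
- by [].
- by [].
- by rewrite /= !inE !natE; lia.
- by rewrite NE.
- by rewrite !inE !natE; lia.
- exact: card_zigzag.
move=> psi [-> psi2 psiS psi_onto].
apply: (@image_eq_caterpillar _ psi collapse_minus psiS psi_onto _ _ _ _ left_minus edge_minus).
- by rewrite psi2 /collapse_minus; case: ifP => //; lia.
- move=> t ht; rewrite !inE !natE /collapse_minus; try lia.
  by do ![case: ifP => ?]; lia.
- by move=> i hi; rewrite /zigzag_left /collapse_minus; do ![case: ifP => ?]; lia.
- by move=> i hi; rewrite /zigzag_right /collapse_minus; do ![case: ifP => ?]; lia.
- by move=> p q; rewrite /edge_minus /left_minus => H1 H2 H3; split => [|r]; lia.
- by move=> p q; rewrite /edge_minus /left_minus => H1 H2 H3; split => [|r]; lia.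
- by rewrite /edge_minus; lia.
- move=> i hi; rewrite /zigzag_left /zigzag_right /collapse_minus /edge_minus.
  by do ?[case: ifP => ?]; lia.
move=> p q hp pq hq H.
have [root|nroot] := boolP ((p == h.+1) && (q == h + n)); [by left|right].
(* Away from the fans the preimages are p + 2 and q - n. The centre of a fan has several preimages;
   one is chosen that makes the sum N + 5 or N + 6. *)
have [lt_q|ge_q] := ltnP q (h + n); have [lt_p|ge_p] := ltnP p (n + 2).
- apply: (@zigzag_preimage collapse_minus p q (p + 2) (q - n));
  by move: H; rewrite /edge_minus /collapse_minus; do ?[case: ifP => ?]; lia.
- apply: (@zigzag_preimage collapse_minus p q (N + 6 - (q - n)) (q - n));
  by move: H; rewrite /edge_minus /collapse_minus; do ?[case: ifP => ?]; lia.
- have [le_h|gt_h] := leqP (n + 8 - p) (h + 2).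
    apply: (@zigzag_preimage collapse_minus p q (p + 2) (n + 8 - p));
    by move: H; rewrite /edge_minus /collapse_minus; do ?[case: ifP => ?]; lia.
  apply: (@zigzag_preimage collapse_minus p q (p + 2) (n + 7 - p));
  by move: H; rewrite /edge_minus /collapse_minus; do ?[case: ifP => ?]; lia.
- apply: (@zigzag_preimage collapse_minus p q (N + 6 - h) h);
  by move: H; rewrite /edge_minus /collapse_minus; do ?[case: ifP => ?]; lia.
Qed.

Lemma relabel_plus :
  relabel (2 : 'Z_N)%R (1 : 'Z_n)%R
    (deletes (ngon N, zigzag N) [:: 4%:R; 5%:R; (4 + h)%:R; (5 + h)%:R]%R) =
  edge_set (@position n h)
    (tree_edges (caterpillar left_plus (n - 2) h.+1) h.+1).
Proof.
have [] := @relabel_deletes N n [:: 4%:R; 5%:R; (4 + h)%:R; (5 + h)%:R]%R 2%:R%R 1%:R%R (zigzag N).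
- by [].
- by [].
- by rewrite /= !inE !natE; lia.
- by rewrite NE.
- by rewrite !inE !natE; lia.
- exact: card_zigzag.
move=> psi [-> psi2 psiS psi_onto].
apply: (@image_eq_caterpillar _ psi collapse_plus psiS psi_onto _ _ _ _ left_plus edge_plus).
- by rewrite psi2 /collapse_plus; case: ifP => //; lia.
- move=> t ht; rewrite !inE !natE /collapse_plus; try lia.
  by do ?[case: ifP => ?]; lia.
- by move=> i hi; rewrite /zigzag_left /collapse_plus; do ?[case: ifP => ?]; lia.
- by move=> i hi; rewrite /zigzag_right /collapse_plus; do ?[case: ifP => ?]; lia.
- by move=> p q; rewrite /edge_plus /left_plus => H1 H2 H3; split => [|r]; lia.
- by move=> p q; rewrite /edge_plus /left_plus => H1 H2 H3; split => [|r]; lia.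
- by rewrite /edge_plus; lia.
- move=> i hi; rewrite /zigzag_left /zigzag_right /collapse_plus /edge_plus.
  by do ?[case: ifP => ?]; lia.
move=> p q hp pq hq H.
have [root|nroot] := boolP ((p == h.+1) && (q == h + n)); [by left|right].
(* Here 4, 5, 6 are merged at position n + 3 and h + 4, h + 5, h + 6 at position h + 1; elsewhere
   the preimages are p + 5 and q - n + 3. *)
have [gt_q|le_q] := ltnP (n + 3) q; last first.
  have [le_n|gt_n] := leqP n p.
    have g4 : collapse_plus 4 = 3 by [].
    apply: (@zigzag_preimage collapse_plus p q (p + 5) 4);
    by move: H; rewrite ?g4 /edge_plus /collapse_plus; do ?[case: ifP => ?]; lia.
  apply: (@zigzag_preimage collapse_plus p q (p + 5) (n + 4 - p));
  by move: H; rewrite /edge_plus /collapse_plus; do ?[case: ifP => ?]; lia.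
have [gt_p|le_p] := ltnP h.+1 p.
  apply: (@zigzag_preimage collapse_plus p q (p + 5) (q - n + 3));
  by move: H; rewrite /edge_plus /collapse_plus; do ?[case: ifP => ?]; lia.
have [le_h|gt_h] := leqP (N + 6 - (q - n + 3)) (h + 6).
  apply: (@zigzag_preimage collapse_plus p q (N + 6 - (q - n + 3)) (q - n + 3));
  by move: H; rewrite /edge_plus /collapse_plus; do ?[case: ifP => ?]; lia.
apply: (@zigzag_preimage collapse_plus p q (N + 5 - (q - n + 3)) (q - n + 3));
by move: H; rewrite /edge_plus /collapse_plus; do ?[case: ifP => ?]; lia.
Qed.

End Zigzag.

(** * The total weights of the two triangulations of A_n *)

Section Values.
Variable n : nat.
Let sum_minus := caterpillar_sum (left_minus n) (weight n).
Let sum_plus := caterpillar_sum (left_plus n) (weight n).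

Lemma weight_LLR p q r : p < q -> q <= n + 2 -> n + 3 <= r ->
  weight n p q r = cross_weight (2 * n) (p + r) (q + r).
Proof.
by move=> ? lq ?; rewrite /weight lq; have -> : (n + 3 <= p) || (r <= n + 2) = false by lia.
Qed.

Lemma weight_LRR p q r : q < r -> p <= n + 2 -> n + 3 <= q ->
  weight n p q r = cross_weight (2 * n) (p + q) (p + r).
Proof.
move=> ? ? ?; rewrite /weight; have -> : (n + 3 <= p) || (r <= n + 2) = false by lia.
by have -> : (q <= n + 2) = false by lia.
Qed.

(** The weight for the consecutive sums j and j + 1; the default 1 covers all j from 8 on. *)
Definition unit_weight j : nat := if j is j'.+1 then nth 1 [:: 4; 3; 3; 2; 1; 1; 0] j' else 3.

Lemma cross_weight_unit s t j : s = 2 * n + j -> t = s.+1 ->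
  cross_weight (2 * n) s t = unit_weight j.
Proof.
move=> -> ->; rewrite /cross_weight.
have -> : (2 * n + j + 3 <= (2 * n + j).+1) = false by lia.
have -> : (2 * n + j + 2 <= (2 * n + j).+1) = false by lia.
rewrite -[X in _ <= X]addn0 !leq_add2l eqn_add2l.
by move: j; do 9?case=> //.
Qed.

Lemma sum_minus_left k p j : p < n + 2 -> n + 3 <= p + k.+2 -> p + (p + k.+2) = 2 * n + j ->
  j <= 7 -> sum_minus k.+1 p = unit_weight j + sum_minus k p.+1.
Proof.
move=> hp hq hj j7; rewrite /sum_minus (@caterpillar_sum_left _ _ k p (p + k.+2)) //.
  by rewrite weight_LLR // (@cross_weight_unit _ _ j) //; lia.
by rewrite /left_minus; lia.
Qed.

Lemma sum_minus_right k p j : p <= n + 2 -> n + 3 <= p + k.+1 -> p + (p + k.+1) = 2 * n + j ->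
  (n + 2 <= p) || (7 <= j) -> sum_minus k.+1 p = unit_weight j + sum_minus k p.
Proof.
move=> hp hq hj j7; have E : (p + k.+1).+1 = p + k.+2 by rewrite !addnS.
rewrite /sum_minus (caterpillar_sum_right _ E); last by rewrite /left_minus; lia.
rewrite weight_LRR //; congr (_ + _); apply: cross_weight_unit; lia.
Qed.

Lemma sum_plus_left k p j : p < n + 2 -> n + 3 <= p + k.+2 -> p + (p + k.+2) = 2 * n + j ->
  (p + k.+2 == n + 3) || (j <= 1) -> sum_plus k.+1 p = unit_weight j + sum_plus k p.+1.
Proof.
move=> hp hq hj j7; rewrite /sum_plus (@caterpillar_sum_left _ _ k p (p + k.+2)) //.
  by rewrite weight_LLR // (@cross_weight_unit _ _ j) //; lia.
by rewrite /left_plus; lia.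
Qed.

Lemma sum_plus_right k p j : p <= n + 2 -> n + 3 <= p + k.+1 -> p + (p + k.+1) = 2 * n + j ->
  1 <= j -> sum_plus k.+1 p = unit_weight j + sum_plus k p.
Proof.
move=> hp hq hj j7; have E : (p + k.+1).+1 = p + k.+2 by rewrite !addnS.
rewrite /sum_plus (caterpillar_sum_right _ E); last by rewrite /left_plus; lia.
rewrite weight_LRR //; congr (_ + _); apply: cross_weight_unit; lia.
Qed.

(** The zigzag triangles weigh 0; only the last two triangles, in the fan at the vertex 2, weigh 1
    each. *)
Lemma sum_minus_zigzag k p : p <= n + 2 -> n + 3 <= p + k.+1 ->
  2 * n + 7 <= p + (p + k.+1) <= 2 * n + 8 -> sum_minus k p = 2.
Proof.
elim: k p => [|k IH] p hp hq hs; first by lia.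
have [s7|s8] : p + (p + k.+2) = 2 * n + 7 \/ p + (p + k.+2) = 2 * n + 8 by lia.
  have [lt_p|ge_p] := ltnP p (n + 2).
    by rewrite (@sum_minus_left _ _ 7) // IH //; lia.
  have [-> Ek] : p = n + 2 /\ k = 1 by lia.
  rewrite Ek (@sum_minus_right _ _ 6); try lia.
  by rewrite (@sum_minus_right _ _ 5); try lia.
by rewrite (@sum_minus_right _ _ 7) ?IH //; lia.
Qed.

(** All triangles weigh 4 except the last three, in the fan at the vertex 3, which weigh 3, 3 and
    2. *)
Lemma sum_plus_zigzag k p : p <= n + 2 -> n + 3 <= p + k.+1 ->
  2 * n + 1 <= p + (p + k.+1) <= 2 * n + 2 -> sum_plus k p = 4 * k - 4.
Proof.
elim: k p => [|k IH] p hp hq hs; first by lia.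
have [eq_q|ne_q] := eqVneq (p + k.+2) (n + 3).
  have [s1|s2] : p + (p + k.+2) = 2 * n + 1 \/ p + (p + k.+2) = 2 * n + 2 by lia.
    have Ek : k = 3 by lia.
    rewrite Ek (@sum_plus_left _ _ 1); try lia.
    rewrite (@sum_plus_left _ _ 2); try lia.
    rewrite (@sum_plus_left _ _ 3); try lia.
    by rewrite (@sum_plus_left _ _ 4); try lia.
  have Ek : k = 2 by lia.
  rewrite Ek (@sum_plus_left _ _ 2); try lia.
  rewrite (@sum_plus_left _ _ 3); try lia.
  by rewrite (@sum_plus_left _ _ 4); try lia.
have [s1|s2] : p + (p + k.+2) = 2 * n + 1 \/ p + (p + k.+2) = 2 * n + 2 by lia.
  by rewrite (@sum_plus_left _ _ 1) ?IH /=; lia.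
by rewrite (@sum_plus_right _ _ 1) ?IH /=; lia.
Qed.

Lemma sum_difference h : 3 <= n -> h = (n + 4)./2 ->
  sum_minus (n - 2) h.+1 + 2 * (2 * n - 10) <= sum_plus (n - 2) h.+1.
Proof.
move=> n3 hE; have [small|large] := ltnP n 13.
  have /allP/(_ n) : all (fun m =>
      caterpillar_sum (left_minus m) (weight m) (m - 2) (m + 4)./2.+1 + 2 * (2 * m - 10)
      <= caterpillar_sum (left_plus m) (weight m) (m - 2) (m + 4)./2.+1) (iota 3 10) by [].
  by rewrite mem_iota n3 small hE; apply.
have [k nE] : exists k, n = k + 6 by exists (n - 6); lia.
have -> : n - 2 = k.+4 by lia.
(* The root edge has sum 4 for odd n and 5 for even n, which fixes the triangles before the zigzags.
   The totals are 6 and 4n - 14 for odd n, 4 and 4n - 16 for even n; both differences are 4n -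
   20. *)
have [odd_n|even_n] : 2 * h + 3 = n + 6 \/ 2 * h + 4 = n + 8 by lia.
  rewrite (@sum_minus_left _ _ 4); try lia.
  rewrite (@sum_minus_left _ _ 5); try lia.
  rewrite (@sum_minus_left _ _ 6); try lia.
  rewrite (@sum_minus_left _ _ 7); try lia.
  rewrite sum_minus_zigzag; try lia.
  rewrite (@sum_plus_right _ _ 3); try lia.
  rewrite (@sum_plus_right _ _ 2); try lia.
  by rewrite sum_plus_zigzag /=; lia.
rewrite (@sum_minus_left _ _ 5); try lia.
rewrite (@sum_minus_left _ _ 6); try lia.
rewrite sum_minus_zigzag; try lia.
rewrite (@sum_plus_right _ _ 4); try lia.
rewrite (@sum_plus_right _ _ 3); try lia.
rewrite (@sum_plus_right _ _ 2); try lia.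
by rewrite sum_plus_zigzag /=; lia.
Qed.

End Values.

Theorem theorem12 (n : nat) (hn : 3 <= n) :
  exists2 d : nat, flip_distance (ngon n) (A_minus n) (A_plus n) d
                 & 2 * n - 10 <= d.
Proof.
have n_gt1 : 1 < n by apply: ltnW.
pose h := (n + 4)./2.
pose tree_of left := caterpillar left (n - 2) h.+1.
pose set_of left := edge_set (@position n h) (tree_edges (tree_of left) h.+1).
have Eminus : A_minus n = set_of (left_minus n) by exact: relabel_minus.
have Eplus : A_plus n = set_of (left_plus n) by exact: relabel_plus.
have w_tree left : width (tree_of left) = n.-1.
  by rewrite width_caterpillar; lia.
have clockwiseE := clockwise_position n_gt1 h.
have potE left : potential (@position n h) (weight n) (set_of left) =
    caterpillar_sum left (weight n) (n - 2) h.+1.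
  rewrite (potential_tree (@position_inj n h) (position_bound n_gt1 h)
    (@vertexK n n_gt1 h) (w_tree _)).
  exact: caterpillar_sumE.
have [p pP] : exists p, flip_path (ngon n) (A_minus n) (A_plus n) p.
  rewrite Eminus Eplus.
  apply: (rotation_connected_path (@position_inj n h) clockwiseE (mem_ngon n_gt1)
    (position_bound n_gt1 h) (@vertexK n n_gt1 h) (@boundary_position n n_gt1 h) (w_tree _)).
  (* Both trees have n - 1 leaves, so rotations connect them. *)
  by apply: rc_width; rewrite !w_tree.
have [d dP] := flip_distance_exists pP; exists d => //.
case: dP => q [qP _] <-.
have := potential_flip_path (@position_inj n h) clockwiseE (@weight_cocycle n) qP.
rewrite Eminus Eplus !potE.
by have := sum_difference hn (erefl h); lia.
Qed.
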